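(* Let $\mathcal{M}$ be a smooth compact $d$-dimensional manifold with a normalized measure, with a fixed finite family of local charts $\{\varphi_k\}_{k=1}^K$, $\varphi_k:[0,1]^d\to\mathcal{M}$, and a fixed smooth partition of unity $\{\psi_k\}_{k=1}^K$ subordinate to these charts. Then there exists a constant $c>0$, depending on the local charts but not on the function $f$ or the measure $\mu$, such that for every function $f\in W^{d,1}(\mathcal{M})$ and every finite (complex) Borel measure $\mu$ on $\mathcal{M}$, $$\left|\int_{\mathcal{M}}f(y)\,\overline{d\mu(y)}\right|\le c\,\mathcal{D}(\mu)\,\|f\|_{W^{d,1}(\mathcal{M})}.$$
   Context: The partition of unity satisfies $\sum_k\psi_k=1$ on $\mathcal{M}$, with $\psi_k$ smooth and supported in the (interior of the) image of the chart $\varphi_k$. The Sobolev norms are $$\|f\|_{W^{n,p}(\mathcal{M})}=\sum_{1\le k\le K}\ \sum_{|\alpha|\le n}\left\{\int_{[0,1]^d}\left|\frac{\partial^\alpha}{\partial x^\alpha}\big(\psi_k(\varphi_k(x))f(\varphi_k(x))\big)\right|^pdx\right\}^{1/p},$$ where $\alpha$ runs over multi-indices. An interval in $\mathcal{M}$ is the image $U=\varphi_k(I)$ under one of the local charts of a $d$-dimensional interval $I\subseteq[0,1]^d$ (a product of $d$ one-dimensional intervals, i.e. with edges parallel to the axes). With $A$ denoting the collection of all intervals in $\mathcal{M}$, the discrepancy of $\mu$ is $$\mathcal{D}(\mu)=\sup_{U\in A}\left|\int_U d\mu(y)\right|.$$ A function in $W^{d,1}(\mathcal{M})$ agrees almost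 everywhere with a continuous function, and $f$ denotes this continuous representative. $\overline{d\mu}$ is the complex conjugate measure. *)

(* Defs.v *)
From HB Require Import structures.
From mathcomp Require Import all_boot all_order all_algebra.
From mathcomp Require Import all_classical all_reals all_analysis.
From mathcomp Require Import complex.

Set Implicit Arguments.
Unset Strict Implicit.
Unset Printing Implicit Defensive.

Import Order.TTheory GRing.Theory Num.Theory.
Import numFieldNormedType.Exports.

Local Open Scope classical_set_scope.
Local Open Scope ring_scope.

Notation normc := ComplexField.Normc.normc.

(* [R[i]^o] carries the topology given by the complex modulus. *)
Record complex_measure d (T : measurableType d) (R : realType) :=
  ComplexMeasure {
    cmeasure :> set T -> R[i] ;
    cmeasure0 : cmeasure set0 = 0 ;
    cmeasure_sigma_additive : forall F : (set T)^nat,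
      (forall n, measurable (F n)) -> trivIset setT F ->
      (fun n => \sum_(0 <= i < n) cmeasure (F i) : R[i]^o) @ \oo
        --> (cmeasure (\bigcup_n F n) : R[i]^o) }.

Section complex_measure.
Context d (T : measurableType d) (R : realType).
Implicit Type mu : complex_measure T R.

Lemma normc_Re_le (z : R[i]) : `|complex.Re z| <= normc z.
Proof.
case: z => a b /=; rewrite -sqrtr_sqr ler_wsqrtr//.
by rewrite lerDl sqr_ge0.
Qed.

Lemma normc_Im_le (z : R[i]) : `|complex.Im z| <= normc z.
Proof.
case: z => a b /=; rewrite -sqrtr_sqr ler_wsqrtr//.
by rewrite lerDr sqr_ge0.
Qed.

Lemma normc_le_Re_Im (z : R[i]) :
  normc z <= `|complex.Re z| + `|complex.Im z|.
Proof.
case: z => a b /=; rewrite -(@ger0_norm _ (`|a| + `|b|)) ?addr_ge0//.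
rewrite -sqrtr_sqr ler_wsqrtr// sqrrD !real_normK ?num_real// lerD2r lerDl.
by rewrite mulrn_wge0// mulr_ge0.
Qed.

Lemma cvg_Re_Im (u : nat -> R[i]) (l : R[i]) :
  (u : nat -> R[i]^o) @ \oo --> (l : R[i]^o) <->
  ((fun n => complex.Re (u n)) @ \oo --> complex.Re l) /\
  ((fun n => complex.Im (u n)) @ \oo --> complex.Im l).
Proof.
have normE (z : R[i]) (e : R) : (`|z| < e%:C%C) = (normc z < e).
  by rewrite normc_def ltcR; case: z.
split=> [/cvgrPdist_lt ul|[/cvgrPdist_lt ur /cvgrPdist_lt ui]].
  split; apply/cvgrPdist_lt => e e0; have := ul e%:C%C; rewrite ltcR => /(_ e0);
    apply: filterS => n; rewrite normE -raddfB; apply: le_lt_trans.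
  - exact: normc_Re_le.
  - exact: normc_Im_le.
apply/cvgrPdist_lt => e; case: e => [a b].
rewrite ltcE /= => /andP[/eqP -> a0].
have a20 : 0 < a / 2 by rewrite divr_gt0.
move: (ur _ a20) (ui _ a20); apply: filterS2 => n; rewrite -!raddfB => hr hi.
rewrite [X in _ < X](_ : _ = a%:C%C)// normE.
by rewrite (le_lt_trans (normc_le_Re_Im _))// (splitr a) ltrD.
Qed.

Definition Re_measure mu : set T -> \bar R := fun A => (complex.Re (mu A))%:E.
Definition Im_measure mu : set T -> \bar R := fun A => (complex.Im (mu A))%:E.

Section charges.
Variable mu : complex_measure T R.

Let Re0 : Re_measure mu set0 = 0%E.
Proof. by rewrite /Re_measure cmeasure0. Qed.
Let Im0 : Im_measure mu set0 = 0%E.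
Proof. by rewrite /Im_measure cmeasure0. Qed.
Let Re_fin A : measurable A -> Re_measure mu A \is a fin_num.
Proof. by []. Qed.
Let Im_fin A : measurable A -> Im_measure mu A \is a fin_num.
Proof. by []. Qed.

Let Re_sigma_additive : semi_sigma_additive (Re_measure mu).
Proof.
move=> F mF tF _; have [h _] := iffLR (cvg_Re_Im _ _)
  (cmeasure_sigma_additive (c := mu) mF tF).
apply/fine_cvgP; split; first by near=> n; rewrite sumEFin.
apply: cvg_trans h; apply: near_eq_cvg; near=> n.
by rewrite /= sumEFin/= raddf_sum.
Unshelve. all: by end_near. Qed.

Let Im_sigma_additive : semi_sigma_additive (Im_measure mu).
Proof.
move=> F mF tF _; have [_ h] := iffLR (cvg_Re_Im _ _)
  (cmeasure_sigma_additive (c := mu) mF tF).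
apply/fine_cvgP; split; first by near=> n; rewrite sumEFin.
apply: cvg_trans h; apply: near_eq_cvg; near=> n.
by rewrite /= sumEFin/= raddf_sum.
Unshelve. all: by end_near. Qed.

HB.instance Definition _ := isCharge.Build _ T R (Re_measure mu)
  Re0 Re_fin Re_sigma_additive.
HB.instance Definition _ := isCharge.Build _ T R (Im_measure mu)
  Im0 Im_fin Im_sigma_additive.

Let conj0 : conjc (mu set0) = 0.
Proof. by rewrite cmeasure0 conjc0. Qed.

Let conj_sigma_additive (F : (set T)^nat) :
  (forall n, measurable (F n)) -> trivIset setT F ->
  (fun n => \sum_(0 <= i < n) conjc (mu (F i)) : R[i]^o) @ \oo
    --> (conjc (mu (\bigcup_n F n)) : R[i]^o).
Proof.
move=> mF tF; have [hr hi] := iffLR (cvg_Re_Im _ _)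
  (cmeasure_sigma_additive (c := mu) mF tF).
apply/cvg_Re_Im; split.
  rewrite (_ : complex.Re _ = complex.Re (mu (\bigcup_n F n))); last first.
    by case: (mu _).
  apply: cvg_trans hr; apply: near_eq_cvg; near=> n.
  by rewrite -raddf_sum; case: (\sum_(_ <= _ < _) _).
rewrite (_ : complex.Im _ = - complex.Im (mu (\bigcup_n F n))); last first.
  by case: (mu _).
apply: cvg_trans (cvgN hi); apply: near_eq_cvg; near=> n.
by rewrite -raddf_sum fctE /=; case: (\sum_(_ <= _ < _) _).
Unshelve. all: by end_near. Qed.

Definition conj_measure : complex_measure T R :=
  @ComplexMeasure _ _ _ (fun A => conjc (mu A)) conj0 conj_sigma_additive.

End charges.

(* By uniqueness of the Jordan decomposition, the value does not depend on the
   Hahn decomposition that is picked. *)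
Definition charge_integral (nu : {charge set T -> \bar R}) (f : T -> R) : R :=
  let P := cid (Hahn_decomposition nu) in
  let N := cid (projT2 P) in
  \int[jordan_pos (projT2 N)]_x f x - \int[jordan_neg (projT2 N)]_x f x.

Definition complex_integral mu (f : T -> R[i]) : R[i] :=
  Complex
    (charge_integral (Re_measure mu) (fun x => complex.Re (f x)) -
     charge_integral (Im_measure mu) (fun x => complex.Im (f x)))
    (charge_integral (Re_measure mu) (fun x => complex.Im (f x)) +
     charge_integral (Im_measure mu) (fun x => complex.Re (f x))).

End complex_measure.

Definition borel (T : ptopologicalType) := g_sigma_algebraType (@open T).

(* The product sigma-algebra, which is also the Borel one. *)
Section measurable_rV.
Context {d : measure_display} {T : measurableType d}.
Variable n : nat.

Let coord (i : 'I_n) (x : 'rV[T]_n) : T := x ord0 i.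

Let rV_set0 : g_sigma_preimage coord set0.
Proof. exact: sigma_algebra0. Qed.

Let rV_setC B : g_sigma_preimage coord B -> g_sigma_preimage coord (~` B).
Proof. exact: sigma_algebraC. Qed.

Let rV_bigcup (F : (set _)^nat) : (forall i, g_sigma_preimage coord (F i)) ->
  g_sigma_preimage coord (\bigcup_i (F i)).
Proof. exact: sigma_algebra_bigcup. Qed.

HB.instance Definition _ := @isMeasurable.Build (measure_tuple_display d)
  'rV[T]_n (g_sigma_preimage coord) rV_set0 rV_setC rV_bigcup.

End measurable_rV.

Lemma measurable_coord d (T : measurableType d) n (i : 'I_n) :
  measurable_fun [set: 'rV[T]_n] (fun x => x ord0 i).
Proof.
move=> _ B mB; rewrite setTI; apply: sub_sigma_algebra => /=.
rewrite -bigcup_seq/=; exists i => /=; first by rewrite mem_index_enum.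
by exists B => //; rewrite setTI.
Qed.

Lemma measurable_fun_rV d d' (T : measurableType d) (T' : measurableType d') n
    (f : T -> 'rV[T']_n) :
  (forall i, measurable_fun setT (fun x => f x ord0 i)) ->
  measurable_fun setT f.
Proof.
move=> mf _ B mB; rewrite setTI.
suff : @measurable _ 'rV[T']_n `<=` [set C | measurable (f @^-1` C)] by exact.
apply: smallest_sub.
  split => [|C mC|F mF] /=; first by rewrite preimage_set0.
    by rewrite setTD preimage_setC; exact: measurableC.
  by rewrite preimage_bigcup; apply: bigcup_measurable => k _; exact: mF.
rewrite -bigcup_seq/= => C [i _ [D mD <-]] /=.
by rewrite setTI -comp_preimage -[X in measurable X]setTI; exact: mf.
Qed.

Section lebesgue_rV.
Variable R : realType.

Let row_cons n (p : 'rV[R]_n * R) : 'rV[R]_n.+1 :=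
  row_mx (p.2%:M : 'rV_1) p.1.

Let measurable_row_cons n : measurable_fun setT (@row_cons n).
Proof.
apply: measurable_fun_rV => i; rewrite /row_cons.
case: (split_ordP (i : 'I_(1 + n))) => j ->.
  rewrite [X in measurable_fun _ X](_ : _ = snd); last first.
    apply/funext => p; apply: etrans (row_mxEl _ _ _ _) _.
    by rewrite mxE (ord1 j) eqxx mulr1n.
  exact: measurable_snd.
rewrite [X in measurable_fun _ X](_ : _ =
    (fun x : 'rV[R]_n => x ord0 j) \o fst); last first.
  by apply/funext => p; apply: etrans (row_mxEr _ _ _ _) _.
exact: measurableT_comp (measurable_coord _) measurable_fst.
Qed.

Section cons_measure.
Variables (n : nat) (m : {measure set 'rV[R]_n -> \bar R}).

Definition cons_measure : set 'rV[R]_n.+1 -> \bar R :=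
  pushforward (m \x (@lebesgue_measure R))%E (@row_cons n).

Let cons_measure0 : cons_measure set0 = 0%E.
Proof. by rewrite /cons_measure /pushforward preimage_set0 measure0. Qed.

Let cons_measure_ge0 A : (0 <= cons_measure A)%E.
Proof. by rewrite /cons_measure /pushforward measure_ge0. Qed.

Let cons_measure_sigma_additive : semi_sigma_additive cons_measure.
Proof.
by apply: measure_semi_sigma_additive; exact: measurable_row_cons.
Qed.

HB.instance Definition _ := isMeasure.Build _ _ _ cons_measure
  cons_measure0 cons_measure_ge0 cons_measure_sigma_additive.

End cons_measure.

Fixpoint lebesgue_rV n : {measure set 'rV[R]_n -> \bar R} :=
  match n with
  | 0 => dirac (0 : 'rV[R]_0)
  | n'.+1 => cons_measure (lebesgue_rV n')
  end.

End lebesgue_rV.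

Section smooth_functions.
Variables (R : realType) (d : nat).
Local Notation E := 'rV[R]_d.
Implicit Types (V : set E) (g : E -> R).

Definition partial (i : 'I_d) g : E -> R := fun x => 'D_(delta_mx 0 i) g x.

Fixpoint differentiable_upto (n : nat) V g : Prop :=
  {in V, continuous g} /\
  match n with
  | 0 => True
  | n'.+1 => forall i, {in V, forall x, derivable g x (delta_mx 0 i)} /\
                       differentiable_upto n' V (partial i g)
  end.

(* Only meant for open [V]. *)
Definition smooth_on V g := forall n, differentiable_upto n V g.

Definition smooth_map_on V (F : E -> E) :=
  forall j, smooth_on V (fun x => F x ord0 j).

Definition partial_multi (alpha : 'I_d -> nat) g : E -> R :=
  foldr (fun i => iter (alpha i) (partial i)) g (enum 'I_d).

Definition unit_cube : set E := [set x | forall i, x ord0 i \in `[0, 1]].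

Definition open_unit_cube : set E := [set x | forall i, x ord0 i \in `]0, 1[].

Definition test_function g :=
  smooth_on setT g /\ closure [set x | g x != 0] `<=` open_unit_cube.

End smooth_functions.
Arguments unit_cube : clear implicits.
Arguments open_unit_cube : clear implicits.

Section manifold.
Variables (R : realType) (d : nat) (M : ptopologicalType).
Local Notation E := 'rV[R]_d.

(* [p = (V, phi)] stands for the inverse [phi : V -> M] of a coordinate map;
   only the values of [phi] on [V] are meaningful. *)
Definition parametrization (p : set E * (E -> M)) :=
  [/\ open p.1, {in p.1, continuous p.2}, {in p.1 &, injective p.2} &
      forall W, open W -> W `<=` p.1 -> open (p.2 @` W)].

Definition smooth_transition (p q : set E * (E -> M)) :=
  smooth_map_on (p.1 `&` p.2 @^-1` (q.2 @` q.1))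
    ('pinv_(fun=> 0) q.1 q.2 \o p.2).

Definition compatible p q := smooth_transition p q /\ smooth_transition q p.

Definition smooth_atlas (A : set (set E * (E -> M))) :=
  [/\ A `<=` parametrization,
      forall y, exists2 p, A p & (p.2 @` p.1) y &
      forall p q, A p -> A q -> compatible p q].

Definition compact_smooth_manifold (A : set (set E * (E -> M))) :=
  [/\ compact [set: M], hausdorff_space M & smooth_atlas A].

Variable A : set (set E * (E -> M)).
Local Notation cube := (unit_cube R d).

(* The charts of the maximal atlas containing [A]. *)
Definition smooth_chart (p : set E * (E -> M)) :=
  parametrization p /\ forall q, A q -> compatible p q.

(* A chart on the closed cube is, as usual for smooth maps on closed sets, one
   that extends to a chart on an open neighbourhood of the cube; only the
   values of [phi] on the cube are meaningful. *)
Definition cube_chart (phi : E -> M) :=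
  exists p : set E * (E -> M),
    [/\ smooth_chart p, cube `<=` p.1 & {in cube, p.2 =1 phi}].

Definition smooth_function (g : M -> R) :=
  forall p, smooth_chart p -> smooth_on p.1 (g \o p.2).

Definition smooth_partition_of_unity K (phi : 'I_K -> E -> M)
    (psi : 'I_K -> M -> R) :=
  [/\ forall k, smooth_function (psi k),
      forall k y, 0 <= psi k y,
      forall k, closure [set y | psi k y != 0] `<=` (phi k @` cube)° &
      forall y, \sum_(k < K) psi k y = 1].

(* The notion of null set common to all measures with a positive smooth
   density in the charts. *)
Definition manifold_null (N : set M) :=
  forall p, smooth_chart p ->
    (@lebesgue_rV R d).-negligible (p.1 `&` p.2 @^-1` N).

Definition ae_equal (f g : M -> R[i]) := manifold_null [set y | f y <> g y].

End manifold.

Section sobolev.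
Variables (R : realType) (d : nat).
Local Notation E := 'rV[R]_d.
Local Notation lambda := (@lebesgue_rV R d).
Local Notation cube := (unit_cube R d).

Definition cube_integrable (g : E -> R[i]) :=
  lambda.-integrable cube (fun x => (complex.Re (g x))%:E) /\
  lambda.-integrable cube (fun x => (complex.Im (g x))%:E).

Definition cube_integral (g : E -> R[i]) : R[i] :=
  Complex (\int[lambda]_(x in cube) complex.Re (g x))
          (\int[lambda]_(x in cube) complex.Im (g x)).

Definition is_weak_derivative (alpha : 'I_d -> nat) (g h : E -> R[i]) :=
  [/\ cube_integrable g, cube_integrable h &
      forall eta : E -> R, test_function eta ->
        cube_integral (fun x => g x * (partial_multi alpha eta x)%:C%C) =
        (-1) ^+ (\sum_i alpha i)%N *
          cube_integral (fun x => h x * (eta x)%:C%C)].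

(* Weak derivatives are unique up to a Lebesgue null set. *)
Definition weak_derivative alpha (g : E -> R[i]) : E -> R[i] :=
  xget (fun=> 0) [set h | is_weak_derivative alpha g h].

Definition cube_Lp_norm (p : R) (g : E -> R[i]) : \bar R :=
  ((\int[lambda]_(x in cube) (normc (g x) `^ p)%:E) `^ p^-1)%E.

Variables (M : ptopologicalType) (K : nat).
Variables (phi : 'I_K -> E -> M) (psi : 'I_K -> M -> R).

Definition localization (f : M -> R[i]) (k : 'I_K) : E -> R[i] :=
  fun x => (psi k (phi k x))%:C%C * f (phi k x).

(* The multi-indices of order at most [n] are the [alpha] in
   [{ffun 'I_d -> 'I_n.+1}] whose sum is at most [n]. *)
Definition in_sobolev (n : nat) (p : R) (f : M -> R[i]) :=
  forall (k : 'I_K) (alpha : {ffun 'I_d -> 'I_n.+1}), (\sum_i alpha i <= n)%N ->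
    exists2 h,
      is_weak_derivative (fun i => alpha i : nat) (localization f k) h &
      (cube_Lp_norm p h < +oo)%E.

Definition sobolev_norm (n : nat) (p : R) (f : M -> R[i]) : \bar R :=
  (\sum_(k < K) \sum_(alpha : {ffun 'I_d -> 'I_n.+1} | (\sum_i alpha i <= n)%N)
    cube_Lp_norm p
      (weak_derivative (fun i => alpha i : nat) (localization f k)))%E.

(* One-dimensional intervals may be open, closed, half-open or degenerate. *)
Definition manifold_interval : set (set M) :=
  [set U | exists (k : 'I_K) (J : 'I_d -> interval R),
    let I := [set x : E | forall i, x ord0 i \in J i] in
    I `<=` cube /\ U = phi k @` I].

Definition discrepancy (mu : complex_measure (borel M) R) : \bar R :=
  ereal_sup [set (normc (mu U))%:E | U in manifold_interval].

End sobolev.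

(* Main.v *)
(** Fix a chart [phi] of the family with its cut-off [psi], write [g] for
    [psi f] read in the chart, and let [h] be the weak mixed derivative of [g]
    of order (1,..,1).  As [g] is continuous and vanishes near the boundary of
    the cube, [g x] is the integral of [h] over the box of all [y] with
    [0 < y_i < x_i]: test the definition of [h] against products of smooth
    one-variable cut-offs that converge to the indicator function of that box.
    Integrating this formula against [mu], Fubini's theorem turns the left-hand
    side into the integral of [h y * mu (U_y)], where [U_y] is the image of the
    box of all [x] with [y_i < x_i < 1].  This is an interval of the manifold,
    so the integral is at most [D(mu)] times the L^1 norm of [h].  Summing over
    the charts proves the inequality with [c = 1]. *)

Require Import Defs.
From HB Require Import structures.
From mathcomp Require Import all_boot all_order all_algebra.
From mathcomp Require Import all_classical all_reals all_analysis.
From mathcomp Require Import measurable_realfun.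
From mathcomp Require Import complex.
From mathcomp Require Import ring.
Import Order.TTheory GRing.Theory Num.Theory.
Import numFieldNormedType.Exports.
Local Open Scope classical_set_scope.
Local Open Scope ring_scope.
Set Implicit Arguments.
Unset Strict Implicit.
Unset Printing Implicit Defensive.

(** * A smooth step function *)

(** The measure may charge Lebesgue null sets, so the formula for [g x] is needed at every point for
    the continuous representative, whereas a weak derivative sees [g] only almost everywhere. The
    value is therefore recovered by averaging: up to sign, the derivatives of the cut-offs form a
    nonnegative kernel of mass 1 concentrated at [x], and continuity controls the deviation almost
    everywhere on its support. Test functions are compactly supported in the open cube, so a cut-off
    of ]0, x_i[ must also rise near 0. The derivative of that rise does not tend to 0; it is
    harmless because [g] vanishes in a strip along the lower faces, whose width comes from
    compactness. The same vanishing removes the face terms of the Koksma-Hlawka inequality and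
    leaves only the derivative of order (1,..,1). Fubini's theorem is applied to the Jordan parts of
    the real and imaginary parts of the measure. The results are put back together into one complex
    integrand before any absolute value is taken, so no numerical factor is lost. *)

Section one_variable.
Variable R : realType.
Implicit Types (f g : R -> R) (n : nat) (t : R).

Fixpoint Cn n f : Prop :=
  match n with
  | 0 => continuous f
  | n'.+1 => (forall t, derivable f t 1) /\ Cn n' (derive1 f)
  end.

Definition smooth f := forall n, Cn n f.

Lemma CnI n f g : (forall t, is_derive t (1 : R) f (g t)) -> Cn n g ->
  Cn n.+1 f.
Proof.
move=> fg Cg; split => [t|]; first exact: (@ex_derive _ _ _ _ _ _ _ (fg t)).
suff -> : (derive1 f) = g by [].
by apply/funext => t; rewrite derive1E; exact: (@derive_val _ _ _ _ _ _ _ (fg t)).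
Qed.

Lemma CnS_is_derive n f t : Cn n.+1 f -> is_derive t (1 : R) f ((derive1 f) t).
Proof. by move=> [df _]; rewrite derive1E; exact: derivableP. Qed.

Lemma CnS n f : Cn n.+1 f -> Cn n f.
Proof.
elim: n f => [f [df _] t|n IH f [df Cf]].
  exact/differentiable_continuous/derivable1_diffP.
by split => //; exact: IH.
Qed.

Lemma Cn_cst n (a : R) : Cn n (fun=> a).
Proof.
elim: n a => [|n IH] a; first by move=> t; exact: cvg_cst.
by apply: (@CnI _ _ (fun=> 0)).
Qed.

Lemma CnD n f g : Cn n f -> Cn n g -> Cn n (fun t => f t + g t).
Proof.
elim: n f g => [f g Cf Cg t|n IH f g Cf Cg].
  by apply: cvgD; [exact: Cf|exact: Cg].
apply: (@CnI _ _ (fun t => derive1 f t + derive1 g t)).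
  by move=> t; apply: is_deriveD;
    [exact: (CnS_is_derive _ Cf)|exact: (CnS_is_derive _ Cg)].
by apply: IH; [case: Cf|case: Cg].
Qed.

Lemma CnM n f g : Cn n f -> Cn n g -> Cn n (fun t => f t * g t).
Proof.
elim: n f g => [f g Cf Cg t|n IH f g Cf Cg].
  by apply: cvgM; [exact: Cf|exact: Cg].
apply: (@CnI _ _ (fun t => f t * (derive1 g) t + g t * (derive1 f) t)).
  by move=> t; apply: is_deriveM;
    [exact: (CnS_is_derive _ Cf)|exact: (CnS_is_derive _ Cg)].
apply: CnD; apply: IH; [exact: CnS|by case: Cg|exact: CnS|by case: Cf].
Qed.

Lemma CnV n f : (forall t, f t != 0) -> Cn n f -> Cn n (fun t => (f t)^-1).
Proof.
move=> f0; elim: n => [Cf t|n IH Cf].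
  by apply: cvgV; [exact: f0|exact: Cf].
apply: (@CnI _ _ (fun t => (-1) * ((f t)^-1 * (f t)^-1 * derive1 f t))).
  move=> t; have h := CnS_is_derive t Cf.
  apply: is_derive_eq (is_deriveV _ _) _; first exact: f0.
  by rewrite /GRing.scale/= mulN1r mulNr expr2 invfM.
apply: CnM; first exact: Cn_cst.
by apply: CnM; [apply: CnM; exact: IH (CnS Cf)|case: Cf].
Qed.

Lemma Cn_affine n f (a b : R) : Cn n f -> Cn n (fun t => f (a * t + b)).
Proof.
have ad t : is_derive t (1 : R) (fun t => a * t + b) a.
  by apply: is_derive_eq; rewrite /GRing.scale/= ?mulr1 ?mul1r ?mulr0 ?addr0 ?add0r.
have ac : continuous (fun t => a * t + b).
  move=> t; exact/differentiable_continuous/derivable1_diffP.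
elim: n f => [f Cf t|n IH f Cf].
  exact: (continuous_comp (ac t) (Cf _)).
apply: (@CnI _ _ (fun t => (derive1 f) (a * t + b) * a)).
  move=> t; apply: (is_derive1_comp (f := f)); exact: (CnS_is_derive _ Cf).
by apply: CnM; [apply: IH; case: Cf|exact: Cn_cst].
Qed.

Lemma smooth_derive1 f : smooth f -> smooth (derive1 f).
Proof. by move=> sf n; case: (sf n.+1). Qed.

Lemma smooth_derivable f t : smooth f -> derivable f t 1.
Proof. by move=> sf; case: (sf 1). Qed.

Lemma smooth_continuous f : smooth f -> continuous f.
Proof. by move=> sf; exact: (sf 0). Qed.

End one_variable.

(** * Functions flat at the origin and the step built from them *)

Section flat.
Variable R : realType.
Implicit Types (f g : R -> R) (n m : nat) (t : R).

Lemma is_derive_quadratic_bound f (C : R) :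
  (forall h, `|f h| <= C * h ^+ 2) -> is_derive (0 : R) (1 : R) f 0.
Proof.
move=> fC; have f0 : f 0 = 0.
  by have := fC 0; rewrite expr2 mulr0 mulr0 normr_le0 => /eqP.
have C0 : 0 <= C by apply: le_trans (normr_ge0 (f 1)) _; have := fC 1; rewrite expr1n mulr1.
have cv : h^-1 *: ((f \o shift 0) (h *: (1 : R)) - f 0) @[h --> 0^'] --> (0 : R).
  apply/cvgr0Pnorm_lt => e e0.
  have eC : 0 < e / (C + 1) by rewrite divr_gt0// ltr_wpDl.
  near=> h.
  have h0 : h != 0 by near: h; exact: nbhs_dnbhs_neq.
  rewrite /= f0 subr0 addr0 /GRing.scale/= mulr1 normrM normfV.
  rewrite ltr_pdivrMl ?normr_gt0// (le_lt_trans (fC h))//.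
  rewrite -real_normK ?num_real// expr2 mulrCA ltr_pM2l ?normr_gt0//.
  have : `|h| < e / (C + 1).
    near: h; apply: dnbhs0_lt => //.
  rewrite ltr_pdivlMr ?ltr_wpDl// => he; apply: le_lt_trans he.
  by rewrite mulrC ler_wpM2l// lerDl.
apply: DeriveDef; last exact: cvg_lim cv.
by apply/cvg_ex; exists 0.
Unshelve. all: by end_near. Qed.

(** The powers of 1 / t make the family closed under differentiation up to linear combinations, so
    smoothness of all members follows by one induction on the order, for all [m] at once. *)
Definition flat m t : R := if 0 < t then t^-1 ^+ m * expR (- t^-1) else 0.

Lemma flat_ge0 m t : 0 <= flat m t.
Proof.
rewrite /flat; case: ifPn => // t0.
by rewrite mulr_ge0 ?expR_ge0// exprn_ge0// invr_ge0 ltW.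
Qed.

(** A single term of the exponential series at 1 / t, the one of degree m + 2, beats the pole with
    two powers of [t] to spare. A quadratic bound is what forces the derivative at 0 to vanish. *)
Lemma flat_bound m t : `|flat m t| <= (m.+2)`!%:R * t ^+ 2.
Proof.
rewrite /flat; case: ifPn => [t0|]; last by rewrite normr0 mulr_ge0 ?sqr_ge0.
have s0 : 0 < t^-1 by rewrite invr_gt0.
rewrite ger0_norm; last by rewrite mulr_ge0 ?expR_ge0// exprn_ge0// ltW.
have := expR_ge1Dxn m.+1 (ltW s0).
rewrite expRN ler_pdivrMr ?expR_gt0// => h.
have {}h : t^-1 ^+ m.+2 / (m.+2)`!%:R <= expR t^-1 by rewrite (le_trans _ h)// lerDr.
rewrite -mulrA mulrC; rewrite ler_pdivrMr ?ltr0n ?fact_gt0// in h.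
rewrite -mulrA.
have -> : t^-1 ^+ m = t ^+ 2 * t^-1 ^+ m.+2.
  by rewrite -[m.+2]add2n exprD mulrA [t^-1 ^+ 2]exprVn mulfV ?mul1r// expf_neq0// gt_eqF.
by rewrite ler_pM2l ?exprn_gt0.
Qed.

Lemma is_derive_flat m t :
  is_derive t (1 : R) (flat m) (flat m.+2 t - m%:R * flat m.+1 t).
Proof.
case: (ltgtP t 0) => [t0|t0|->].
- rewrite /flat ltNge ltW//= mulr0 subr0.
  apply: (near_eq_is_derive (f := cst 0)).
  by near=> s; rewrite ltNge ltW//=; near: s; exact: lt_nbhsl.
- rewrite /flat t0.
  apply: (near_eq_is_derive (f := (fun s : R => s^-1 ^+ m * expR (- s^-1) : R))).
    by near=> s; rewrite (_ : 0 < s)//; near: s; exact: lt_nbhsr.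
  have di : is_derive t (1 : R) (fun s => s^-1) (- t ^- 2).
    have := @is_deriveV _ id t 1 1 (lt0r_neq0 t0) _; rewrite /GRing.scale/= mulr1; exact.
  have dm : is_derive t (1 : R) (fun s => s^-1 ^+ m) (m%:R * t^-1 ^+ m.-1 * - t ^- 2).
    by have := is_deriveX m di; rewrite exprfctE.
  have dN : is_derive t (1 : R) (fun s => - s^-1) (t ^- 2).
    by apply: is_derive_eq; rewrite opprK.
  have de : is_derive t (1 : R) (fun s => expR (- s^-1)) (expR (- t^-1) * t ^- 2).
    exact: (is_derive1_comp _ dN).
  apply: is_derive_eq (is_deriveM dm de) _.
  rewrite /GRing.scale/=; case: m {dm} => [|m].
    by rewrite /= !expr0 !mul0r mulr0 addr0 subr0 mul1r exprVn mulrC.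
  by rewrite -!exprVn !exprS expr0 /=; ring.
- have f0 k : flat k 0 = 0 by rewrite /flat ltxx.
  rewrite !f0 mulr0 subr0; exact: is_derive_quadratic_bound (flat_bound m).
Unshelve. all: by end_near. Qed.

Lemma smooth_flat m : smooth (flat m).
Proof.
move=> n; elim: n m => [|n IH] m.
  move=> t; apply/differentiable_continuous/derivable1_diffP.
  exact: (@ex_derive _ _ _ _ _ _ _ (is_derive_flat m t)).
apply: (CnI (is_derive_flat m)).
have -> : (fun t => flat m.+2 t - m%:R * flat m.+1 t) =
    (fun t => flat m.+2 t + (- m%:R) * flat m.+1 t).
  by apply/funext => t; rewrite mulNr.
by apply: CnD; [exact: IH|apply: CnM; [exact: Cn_cst|exact: IH]].
Qed.

(** The denominator never vanishes, since [t] and [1 - t] are not both nonpositive. The step is 0 up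
    to 0 and 1 from 1 on. *)
Definition smooth_step t : R := flat 0 t * (flat 0 t + flat 0 (1 - t))^-1.

Let den_gt0 t : 0 < flat 0 t + flat 0 (1 - t).
Proof.
rewrite /flat !expr0 !mul1r subr_gt0.
case: (ltP 0 t) => t0; first by rewrite ltr_wpDr ?expR_gt0//; case: ifP; rewrite ?expR_ge0.
by rewrite add0r (le_lt_trans t0)// expR_gt0.
Qed.

Let flat_onem n : Cn n (fun t => flat 0 (1 - t)).
Proof.
have -> : (fun t => flat 0 (1 - t)) = (fun t => flat 0 ((-1) * t + 1)).
  by apply/funext => t; rewrite mulN1r addrC.
exact/Cn_affine/smooth_flat.
Qed.

Lemma smooth_smooth_step : smooth smooth_step.
Proof.
move=> n; apply: CnM; first exact: smooth_flat.
apply: CnV; first by move=> t; rewrite gt_eqF.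
by apply: CnD; [exact: smooth_flat|exact: flat_onem].
Qed.

Lemma smooth_step_ge0 t : 0 <= smooth_step t.
Proof. by rewrite divr_ge0 ?flat_ge0// ltW. Qed.

Lemma smooth_step_le1 t : smooth_step t <= 1.
Proof. by rewrite ler_pdivrMr// mul1r lerDl flat_ge0. Qed.

Lemma smooth_step_le0 t : t <= 0 -> smooth_step t = 0.
Proof. by move=> t0; rewrite /smooth_step {1}/flat ltNge t0 mul0r. Qed.

Lemma smooth_step_ge1 t : 1 <= t -> smooth_step t = 1.
Proof.
move=> t1; rewrite /smooth_step [flat 0 (1 - t)]/flat subr_gt0 ltNge t1/= addr0.
by rewrite divff// /flat (lt_le_trans ltr01 t1) expr0 mul1r gt_eqF// expR_gt0.
Qed.

(** The quotient rule leaves a sum of two products of flat functions over a square. Nonnegativity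
    makes the rescaled derivative a probability density, so that averaging against it does not
    amplify errors. *)
Lemma derive1_smooth_step_ge0 t : 0 <= derive1 smooth_step t.
Proof.
have d1 s : is_derive s (1 : R) (flat 0) (flat 2 s).
  by apply: is_derive_eq (is_derive_flat 0 s) _; rewrite mul0r subr0.
have db : is_derive t (1 : R) (fun s => 1 - s) (-1).
  have := is_deriveB (is_derive_cst (1 : R) t 1) (is_derive_id t (1 : R)).
  by rewrite sub0r.
have d2 := @is_derive1_comp _ (flat 0) (fun s => 1 - s) t _ _ (d1 (1 - t)) db.
have dd := is_deriveD (d1 t) d2.
have dV := @is_deriveV _ (fun s => flat 0 s + flat 0 (1 - s)) t _ 1 (lt0r_neq0 (den_gt0 t)) dd.
have dS := is_deriveM (d1 t) dV.
rewrite derive1E [X in 0 <= X](@derive_val _ _ _ _ _ _ _ dS) /GRing.scale/=.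
have -> : flat 0 t * (- (flat 0 t + flat 0 (1 - t)) ^- 2 * (flat 2 t + flat 2 (1 - t) * -1)) +
  (flat 0 t + flat 0 (1 - t))^-1 * flat 2 t =
  (flat 0 t + flat 0 (1 - t)) ^- 2 * (flat 0 t * flat 2 (1 - t) + flat 2 t * flat 0 (1 - t)).
  by field; rewrite gt_eqF.
by rewrite mulr_ge0 ?invr_ge0 ?exprn_ge0 ?addr_ge0 ?mulr_ge0 ?flat_ge0.
Qed.

End flat.

(** * Test functions of product form *)

Section product_functions.
Variables (R : realType) (d : nat).
Implicit Types (Th : 'I_d -> R -> R) (i j : 'I_d).
Local Notation E := 'rV[R]_d.

Definition prod_coord Th : E -> R := fun x => \prod_i Th i (x ord0 i).

Lemma prod_coord_continuous Th : (forall i, continuous (Th i)) ->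
  continuous (prod_coord Th).
Proof.
move=> cTh x; rewrite /prod_coord; apply: continuous_big => //.
- by move=> y; exact: mul_continuous.
- by move=> i _ z; apply: (@continuous_comp _ _ _ (fun y : E => y ord0 i) (Th i));
    [exact: coord_continuous|exact: cTh].
Qed.

Let derive_at Th i := fun j => if j == i then derive1 (Th j) else Th j.

Lemma is_derive_prod_coord Th i (x : E) : derivable (Th i) (x ord0 i) 1 ->
  is_derive x (delta_mx ord0 i : E) (prod_coord Th) (prod_coord (derive_at Th i) x).
Proof.
move=> dT.
set C := \prod_(j < d | j != i) Th j (x ord0 j).
have -> : prod_coord (derive_at Th i) x = derive1 (Th i) (x ord0 i) * C.
  rewrite /prod_coord (bigD1 i)//= /derive_at eqxx; congr (_ * _).
  by apply: eq_bigr => j /negbTE ->.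
have cv : h^-1 *: ((prod_coord Th \o shift x) (h *: (delta_mx ord0 i : E)) - prod_coord Th x)
    @[h --> 0^'] --> derive1 (Th i) (x ord0 i) * C.
  have -> : (fun h : R => h^-1 *: ((prod_coord Th \o shift x) (h *: (delta_mx ord0 i : E))
      - prod_coord Th x)) =
      (fun h : R => (h^-1 *: ((Th i \o shift (x ord0 i)) (h *: (1 : R)) - Th i (x ord0 i))) * C).
    apply/funext => h; rewrite /prod_coord /= [in LHS](bigD1 i)//= [X in _ - X](bigD1 i)//=.
    rewrite !mxE !eqxx/= /GRing.scale/=.
    rewrite (eq_bigr (fun j => Th j (x ord0 j))); last first.
      by move=> j ji; rewrite !mxE (negbTE ji) andbF mulr0 add0r.
    by rewrite -mulrBl mulrA.
  by apply: cvgMl; rewrite derive1E; exact: dT.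
apply: DeriveDef; last exact: cvg_lim cv.
by apply/cvg_ex; exists (derive1 (Th i) (x ord0 i) * C).
Qed.

Lemma partial_prod_coord Th i : smooth (Th i) ->
  partial i (prod_coord Th) = prod_coord (derive_at Th i).
Proof.
move=> sT; apply/funext => x; rewrite /partial.
have dT := is_derive_prod_coord (@smooth_derivable _ _ (x ord0 i) sT).
exact: (@derive_val _ _ _ _ _ _ _ dT).
Qed.

Let smooth_derive_at Th i : (forall j, smooth (Th j)) ->
  forall j, smooth (derive_at Th i j).
Proof. by move=> sT j; rewrite /derive_at; case: ifP => // _; exact: smooth_derive1. Qed.

Lemma smooth_on_prod_coord Th : (forall i, smooth (Th i)) ->
  smooth_on setT (prod_coord Th).
Proof.
move=> sT n; elim: n Th sT => [|n IH] Th sT.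
  by split => // x _; apply: prod_coord_continuous => i; exact: smooth_continuous.
split; first by move=> x _; apply: prod_coord_continuous => i; exact: smooth_continuous.
move=> i; split.
  move=> x _; apply: (@ex_derive _ _ _ _ _ _ _ (is_derive_prod_coord _)).
  exact: smooth_derivable.
by rewrite partial_prod_coord//; exact/IH/smooth_derive_at.
Qed.

Lemma partial_multi1_prod_coord Th : (forall i, smooth (Th i)) ->
  partial_multi (fun=> 1%N) (prod_coord Th) = prod_coord (fun i => derive1 (Th i)).
Proof.
move=> sT; rewrite /partial_multi.
(* [partial_multi] folds over the list of coordinates, so the claim is generalized to the list
   already processed; as it has no duplicates, each factor is differentiated at most once. *)
have main s : uniq s -> foldr (fun i => iter 1 (partial i)) (prod_coord Th) s =
    prod_coord (fun j => if j \in s then derive1 (Th j) else Th j).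
  elim: s => [_|i s IH /= /andP[nis us]]; first by congr prod_coord.
  rewrite IH// partial_prod_coord.
    congr prod_coord; apply/funext => j; rewrite /derive_at inE.
    by case: eqP => [->|//]; rewrite (negbTE nis).
  by case: ifP => // _; exact: smooth_derive1.
rewrite main ?enum_uniq//; congr prod_coord; apply/funext => j.
by rewrite mem_enum.
Qed.

Lemma test_function_prod_coord Th (a b : 'I_d -> R) : (forall i, smooth (Th i)) ->
  (forall i, 0 < a i) -> (forall i, b i < 1) ->
  (forall i t, Th i t != 0 -> a i <= t <= b i) -> test_function (prod_coord Th).
Proof.
move=> sT a0 b1 Tab; split; first exact: smooth_on_prod_coord.
move=> x cx i.
have : closed [set y : E | y ord0 i \in `[a i, b i]].
  apply: (@closed_comp _ _ (fun y : E => y ord0 i) [set` `[a i, b i]]).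
    by move=> y _; exact: coord_continuous.
  exact: itv_closed.
rewrite closure_id => h.
have : [set y : E | y ord0 i \in `[a i, b i]] x.
  rewrite h; apply: closureS cx => y /= y0; rewrite in_itv/=.
  apply: Tab; apply: contra_neq y0 => y0.
  by rewrite /prod_coord (bigD1 i)//= y0 mul0r.
rewrite /= !in_itv/= => /andP[ax xb].
by rewrite (lt_le_trans (a0 i))//= (le_lt_trans xb).
Qed.

End product_functions.

(** * Lebesgue measure on row vectors *)

Section lebesgue_rV_theory.
Variable R : realType.

(* The bijection used in the definition of [cons_measure]. *)
Let row_cons n (p : 'rV[R]_n * R) : 'rV[R]_n.+1 :=
  row_mx (p.2%:M : 'rV_1) p.1.

Lemma row_cons0 n (p : 'rV[R]_n * R) : row_cons p ord0 ord0 = p.2.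
Proof.
have -> : ord0 = lshift n (ord0 : 'I_1) by exact: val_inj.
by apply: etrans (row_mxEl _ _ _ _) _; rewrite mxE eqxx mulr1n.
Qed.

Lemma row_consS n (p : 'rV[R]_n * R) j :
  row_cons p ord0 (lift ord0 j) = p.1 ord0 j.
Proof.
have -> : lift ord0 j = rshift 1 j by exact: val_inj.
exact: etrans (row_mxEr _ _ _ _) _.
Qed.

Lemma measurable_row_cons n : measurable_fun setT (@row_cons n).
Proof.
apply: measurable_fun_rV => i; case: (unliftP ord0 i) => [j ->|->].
  rewrite [X in measurable_fun _ X](_ : _ = (fun x : 'rV[R]_n => x ord0 j) \o fst).
    exact: measurableT_comp (measurable_coord _) measurable_fst.
  by apply/funext => p; exact: row_consS.
rewrite [X in measurable_fun _ X](_ : _ = snd); first exact: measurable_snd.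
by apply/funext => p; exact: row_cons0.
Qed.

Lemma measurable_box n (J : 'I_n -> set R) : (forall i, measurable (J i)) ->
  measurable [set x : 'rV[R]_n | forall i, J i (x ord0 i)].
Proof.
move=> mJ.
have -> : [set x : 'rV[R]_n | forall i, J i (x ord0 i)] =
    \bigcap_(i in [set: 'I_n]) ((fun x : 'rV[R]_n => x ord0 i) @^-1` J i).
  by apply/seteqP; split => [x xJ i _|x xJ i]; exact: xJ.
apply: fin_bigcap_measurable; first exact: finite_finset.
by move=> i _; rewrite -[X in measurable X]setTI; exact: measurable_coord.
Qed.

Lemma lebesgue_rV_box_lty n (a b : R) :
  (lebesgue_rV R n [set x | forall i, x ord0 i \in `[a, b]] < +oo)%E.
Proof.
elim: n => [|n IH] /=; first by rewrite diracE ltry.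
rewrite /cons_measure /pushforward.
have -> : @row_cons n @^-1` [set x | forall i, x ord0 i \in `[a, b]] =
    [set x : 'rV[R]_n | forall i, x ord0 i \in `[a, b]] `*` `[a, b]%classic.
  apply/seteqP; split => [[x t]/= h|[x t]/= [h1 h2] i].
    by split => [i|]; [have := h (lift ord0 i); rewrite row_consS|
      have := h ord0; rewrite row_cons0].
  by case: (unliftP ord0 i) => [j ->|->]; rewrite ?row_consS ?row_cons0.
rewrite product_measure1E//=; last exact: (@measurable_box n (fun=> `[a, b]%classic)).
rewrite lte_mul_pinfty// ?ge0_fin_numE//= lebesgue_measure_itv/=.
by case: ifP => // _; rewrite -EFinB ltry.
Qed.

(* [lebesgue_rV R n] is a packed measure computed by recursion on [n], to which no
   instance can be attached; [leb] names the same function, so that it can carry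
   the sigma-finite structure required by Fubini's theorem. *)
Definition leb n : set 'rV[R]_n -> \bar R := lebesgue_rV R n.
Arguments leb : clear implicits.
HB.instance Definition _ n := Measure.copy (leb n) (lebesgue_rV R n).

Let leb_sigma_finite n : sigma_finite setT (leb n).
Proof.
exists (fun k => [set x : 'rV[R]_n | forall i, x ord0 i \in `[- k%:R, k%:R]]).
  apply/esym/seteqP; split => // x _.
  exists (Num.truncn (\sum_i `|x ord0 i|)).+1 => // i /=.
  rewrite in_itv/= -ler_norml (le_trans _ (ltW (truncnS_gt _)))//.
  by rewrite (bigD1 i)//= lerDl sumr_ge0.
move=> k; split; first exact: (@measurable_box n (fun=> `[- k%:R, k%:R]%classic)).
exact: lebesgue_rV_box_lty.
Qed.
HB.instance Definition _ n := Measure_isSigmaFinite.Build _ _ _ (leb n) (@leb_sigma_finite n).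

Lemma measurable_prod_coord n (f : 'I_n -> R -> R) :
  (forall i, measurable_fun setT (f i)) -> measurable_fun setT (prod_coord f).
Proof.
move=> mf; apply: measurable_prod => i _.
exact: measurableT_comp (mf i) (measurable_coord i).
Qed.

Lemma integral_prod_coordT n (f : 'I_n -> R -> R) :
  (forall i, measurable_fun setT (f i)) -> (forall i t, 0 <= f i t) ->
  (forall i, \int[lebesgue_measure]_t (f i t)%:E = 1)%E ->
  (\int[lebesgue_rV R n]_x (prod_coord f x)%:E = 1)%E.
Proof.
elim: n f => [|n IH] f mf f0 f1 /=.
  rewrite integral_dirac//; first by rewrite diracE in_setT mul1e /prod_coord big_ord0.
  by apply/measurable_EFinP; exact: measurable_prod_coord.
have p0 m (g : 'I_m -> R -> R) x : (forall i t, 0 <= g i t) -> 0 <= prod_coord g x.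
  by move=> g0; rewrite /prod_coord prodr_ge0.
have mp : measurable_fun setT (fun x => (prod_coord f x)%:E).
  by apply/measurable_EFinP; exact: measurable_prod_coord.
rewrite ge0_integral_pushforward//; last 2 first.
- exact: measurable_row_cons.
- by move=> x _; rewrite lee_fin p0.
rewrite (@eq_measure_integral _ _ _ _ (leb n \x lebesgue_measure)%E)//=.
rewrite fubini_tonelli1/=; last 2 first.
- exact: measurableT_comp mp (@measurable_row_cons n).
- by move=> x; rewrite lee_fin p0.
rewrite /fubini_F /=.
have E x : (\int[lebesgue_measure]_y (prod_coord f (row_cons (x, y)))%:E =
    (prod_coord (fun i => f (lift ord0 i)) x)%:E)%E.
  under eq_integral => y _.
    rewrite /prod_coord big_ord_recl row_cons0/= mulrC EFinM.
    under eq_bigr do rewrite row_consS/=.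
    over.
  rewrite ge0_integralZl//=.
  - by rewrite f1 mule1.
  - by apply/measurable_EFinP; exact: mf.
  - by move=> y _; rewrite lee_fin.
  - by rewrite lee_fin prodr_ge0.
rewrite (eq_integral (fun x => (prod_coord (fun i => f (lift ord0 i)) x)%:E)).
  by apply: IH.
by move=> x _; exact: E.
Qed.

Lemma integral_prod_coord n (f : 'I_n -> R -> R) :
  (forall i, measurable_fun setT (f i)) -> (forall i t, 0 <= f i t) ->
  (forall i, \int[lebesgue_measure]_(t in `[0%R, 1%R]) (f i t)%:E = 1)%E ->
  (\int[lebesgue_rV R n]_(x in unit_cube R n) (prod_coord f x)%:E = 1)%E.
Proof.
move=> mf f0 f1; rewrite integral_mkcond.
(* The indicator of the cube is a product of indicators, so it can be absorbed into the factors. *)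
rewrite -(@integral_prod_coordT n (fun i : 'I_n => f i \_ ([set` `[0%R, 1%R]] : set R))).
- apply: eq_integral => x _; rewrite patchE /prod_coord.
  case: ifPn => [/set_mem xc|xc].
    by congr EFin; apply: eq_bigr => i _; rewrite patchE mem_set//; exact: xc.
  apply/eqP; rewrite eq_sym eqe.
  have [i xi] : exists i, x ord0 i \notin `[0, 1].
    apply/not_existsP => h; move/negP: xc; apply; apply/mem_set => i.
    exact/negPn/negP/h.
  rewrite (bigD1 i)//= patchE memNset ?mul0r//; exact/negP.
- by move=> i; apply/(measurable_restrictT _ _).1 => //; exact: measurable_funTS.
- by move=> i t; rewrite patchE; case: ifP.
- move=> i; rewrite -(f1 i) [RHS]integral_mkcond; apply: eq_integral => t _.
  by rewrite !patchE; case: ifP.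
Qed.

End lebesgue_rV_theory.

(** * Recovering a function from its mixed derivative *)

Section cutoff.
Variable R : realType.
Implicit Types (x k t : R).
Local Notation S := (@smooth_step R).

Lemma derive1_eq0_near (f : R -> R) (c t : R) : (\forall s \near t, f s = c) ->
  derive1 f t = 0.
Proof.
move=> fc; rewrite derive1E (near_eq_derive _ (g := cst c))//.
exact: derive_cst.
Qed.

Lemma derive1_smooth_step_eq0 t : ~~ (0 <= t <= 1) -> derive1 S t = 0.
Proof.
rewrite negb_and -!ltNge => /orP[t0|t1].
  apply: (@derive1_eq0_near _ 0); near=> s; rewrite smooth_step_le0// ltW//.
  by near: s; exact: lt_nbhsl.
apply: (@derive1_eq0_near _ 1); near=> s; rewrite smooth_step_ge1// ltW//.
by near: s; exact: lt_nbhsr.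
Unshelve. all: by end_near. Qed.

(* As [k] tends to infinity this tends to the indicator function of ]0, x[, and
   its derivative is an approximation of minus the Dirac mass at [x] plus a term
   that lives on ]0, 2 / k]; the first factor makes the support compact in ]0, 1[
   when [x < 1]. *)
Definition cutoff x k t := S (k * t + -1) * S (- k * t + k * x).

(** Minus the derivative of the second factor of [cutoff]: an approximate identity at [x], living on
    [x - 1/k, x]. It is one-sided, and it has full mass on the unit interval once 1/k <= x <= 1. *)
Definition step_kernel x k t := k * derive1 S (- k * t + k * x).

Lemma smooth_cutoff x k : smooth (cutoff x k).
Proof.
by move=> n; apply: CnM; apply: Cn_affine; exact: smooth_smooth_step.
Qed.

Lemma cutoff_ge0 x k t : 0 <= cutoff x k t.
Proof. by rewrite mulr_ge0// smooth_step_ge0. Qed.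

Lemma cutoff_le1 x k t : cutoff x k t <= 1.
Proof. by rewrite mulr_ile1// ?smooth_step_ge0// smooth_step_le1. Qed.

Lemma cutoff_support x k t : 0 < k -> cutoff x k t != 0 -> k^-1 <= t <= x.
Proof.
move=> k0; rewrite mulf_eq0 negb_or => /andP[h1 h2]; apply/andP; split.
  apply: contra_neqT h1; rewrite -ltNge => h1; apply: smooth_step_le0.
  by rewrite subr_le0 -ler_pdivlMl// mulr1 ltW.
apply: contra_neqT h2; rewrite -ltNge => h2; apply: smooth_step_le0.
by rewrite mulNr addrC subr_le0 ler_pM2l// ltW.
Qed.

Lemma is_derive_step_reflect x k t :
  is_derive t (1 : R) (fun s => S (- k * s + k * x)) (- step_kernel x k t).
Proof.
have sS := @smooth_smooth_step R.
have da : is_derive t (1 : R) (fun s => - k * s + k * x) (- k).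
  by apply: is_derive_eq; rewrite /GRing.scale/= ?mulr1 ?mul1r ?mulr0 ?addr0 ?add0r.
have := @is_derive1_comp _ S (fun s => - k * s + k * x) t _ _ (CnS_is_derive _ (sS 1%N)) da.
by move=> dS; apply: is_derive_eq dS _; rewrite /step_kernel mulrN mulrC.
Qed.

(** The bound 2 / k is where the first factor reaches its plateau, k t - 1 >= 1; beyond it that
    factor is locally constant. *)
Lemma derive1_cutoff x k t : 0 < k -> 2 / k < t -> derive1 (cutoff x k) t = - step_kernel x k t.
Proof.
move=> k0 kt; rewrite derive1E -(@derive_val _ _ _ _ _ _ _ (is_derive_step_reflect x k t)).
apply: near_eq_derive; near=> s; rewrite /cutoff smooth_step_ge1 ?mul1r//.
rewrite lerBrDr -[1 + 1]/(2 : R) mulrC -ler_pdivrMr// ltW//.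
by near: s; exact: lt_nbhsr.
Unshelve. all: by end_near. Qed.

Lemma step_kernel_ge0 x k t : 0 < k -> 0 <= step_kernel x k t.
Proof. by move=> k0; rewrite mulr_ge0 ?derive1_smooth_step_ge0// ltW. Qed.

Lemma step_kernel_support x k t : 0 < k -> step_kernel x k t != 0 -> 0 <= x - t <= k^-1.
Proof.
move=> k0; rewrite mulf_eq0 negb_or => /andP[_]; apply: contraR => h.
rewrite derive1_smooth_step_eq0//; apply: contra h.
rewrite mulNr addrC -mulrBr pmulr_rge0// => /andP[-> h] /=.
by rewrite -ler_pdivlMl// mulr1 in h.
Qed.

Lemma continuous_step_kernel x k : continuous (step_kernel x k).
Proof.
have : smooth (step_kernel x k).
  move=> n; apply: CnM; first exact: Cn_cst.
  apply: Cn_affine; exact: smooth_derive1 (@smooth_smooth_step R) _.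
exact: smooth_continuous.
Qed.

(** The antiderivative is the negated reflected step. It equals -1 at 0 because k x >= 1, and 0 at 1
    because x <= 1. *)
Lemma integral_step_kernel x k : 0 < k -> 1 <= k * x -> x <= 1 ->
  (\int[lebesgue_measure]_(t in `[0%R, 1%R]) (step_kernel x k t)%:E = 1)%E.
Proof.
move=> k0 kx x1.
pose F t := - S (- k * t + k * x).
have dF t : is_derive t (1 : R) F (step_kernel x k t).
  by apply: is_derive_eq (is_deriveN (is_derive_step_reflect x k t)) _; rewrite opprK.
have cF : continuous F.
  move=> t; apply/differentiable_continuous/derivable1_diffP.
  exact: (@ex_derive _ _ _ _ _ _ _ (dF t)).
rewrite (continuous_FTC2 (F := F))//.
- rewrite /F mulr1 mulr0 add0r smooth_step_le0 ?smooth_step_ge1//.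
    by rewrite -EFinB oppr0 opprK add0r.
  by rewrite addrC -[k in X in _ - X]mulr1 -mulrBr pmulr_rle0// subr_le0.
- exact/continuous_subspaceT/continuous_step_kernel.
- split; [|exact: cvg_at_right_filter (cF _)|exact: cvg_at_left_filter (cF _)].
  by move=> t _; exact: (@ex_derive _ _ _ _ _ _ _ (dF t)).
- by move=> t _; rewrite derive1E; exact: (@derive_val _ _ _ _ _ _ _ (dF t)).
Qed.

Lemma cutoff_cvg x t : 0 < x ->
  cutoff x n.+1%:R t @[n --> \oo] --> (((0 < t) && (t < x))%:R : R).
Proof.
(* At a fixed point the sequence is eventually constant. The threshold 2 serves both factors: the
   first is 1 once k t >= 2, the second already once k (x - t) >= 1. *)
move=> x0; have h (s : R) : 0 < s -> \forall n \near \oo, 2 <= n.+1%:R * s.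
  move=> s0; near=> n; rewrite -ler_pdivrMr// (@le_trans _ _ n%:R)//; last by rewrite ler_nat.
  by near: n; exact: nbhs_infty_ger.
apply: cvg_near_cst; case: (ltP 0 t) => t0 /=; last first.
  near=> n; rewrite /cutoff smooth_step_le0 ?mul0r//.
  by rewrite subr_le0 (le_trans _ ler01)// mulr_ge0_le0.
case: (ltP t x) => tx.
  near=> n; rewrite /cutoff !smooth_step_ge1 ?mul1r//.
    rewrite mulNr addrC -mulrBr (@le_trans _ _ 2) ?ler1n//.
    by near: n; apply: h; rewrite subr_gt0.
  by rewrite lerBrDr; near: n; exact: h.
near=> n; rewrite /cutoff [X in _ * X]smooth_step_le0 ?mulr0//.
by rewrite mulNr addrC -mulrBr mulr_ge0_le0// subr_le0.
Unshelve. all: by end_near. Qed.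

End cutoff.

Section representation.
Variables (R : realType) (d : nat).
Local Notation E := 'rV[R]_d.
Local Notation lambda := (lebesgue_rV R d).
Local Notation cube := (unit_cube R d).
Implicit Types (g h : E -> R) (x y : E).

Lemma measurable_cube : measurable cube.
Proof. exact: (@measurable_box _ d (fun=> `[0, 1]%classic)). Qed.

Definition lower_box x : E -> R := prod_coord (fun i t => ((0 < t) && (t < x ord0 i))%:R).

Lemma measurable_cutoff (x k : R) : measurable_fun setT (cutoff x k).
Proof.
apply: continuous_measurable_fun; apply: smooth_continuous; exact: smooth_cutoff.
Qed.

Lemma measurable_step_kernel (x k : R) : measurable_fun setT (step_kernel x k).
Proof. by apply: continuous_measurable_fun; exact: continuous_step_kernel. Qed.

(** [Th] is the smooth substitute for [lower_box], and [Bp] is its mixed derivative up to the sign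
    (-1)^d, except near the lower faces, where the first factors of the cut-offs still vary. *)
Let Th x k := prod_coord (fun i => cutoff (x ord0 i) k) : E -> R.
Let Bp x k := prod_coord (fun i => step_kernel (x ord0 i) k) : E -> R.

Let Th_ge0 x k y : 0 <= Th x k y.
Proof. by rewrite /Th /prod_coord prodr_ge0// => i _; exact: cutoff_ge0. Qed.

Let Th_le1 x k y : Th x k y <= 1.
Proof.
by rewrite /Th /prod_coord prodr_ile1// => i _; rewrite cutoff_ge0 cutoff_le1.
Qed.

Let mTh x k : measurable_fun setT (Th x k).
Proof. by apply: measurable_prod_coord => i; exact: measurable_cutoff. Qed.

Let mBp x k : measurable_fun setT (Bp x k).
Proof. by apply: measurable_prod_coord => i; exact: measurable_step_kernel. Qed.

Let Bp_ge0 x k y : 0 < k -> 0 <= Bp x k y.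
Proof. by move=> k0; rewrite /Bp /prod_coord prodr_ge0// => i _; exact: step_kernel_ge0. Qed.

Lemma measurable_lower_box x : measurable_fun setT (lower_box x).
Proof.
apply: measurable_prod_coord => i.
rewrite (_ : (fun _ => _) = \1_(`]0, x ord0 i[%classic)); first exact: measurable_indic.
by apply/funext => t; rewrite indicE mem_setE in_itv.
Qed.

Let cvg_Th x y : open_unit_cube R d x ->
  Th x n.+1%:R y @[n --> \oo] --> lower_box x y.
Proof.
move=> xo; rewrite /Th /lower_box /prod_coord.
apply: cvg_big => // [z|i _]; first exact: mul_continuous.
by apply: cutoff_cvg; have := xo i; rewrite in_itv/= => /andP[].
Qed.

Let cvg_integral_Th h x : open_unit_cube R d x ->
  lambda.-integrable cube (EFin \o h) ->
  \int[lambda]_(y in cube) (h y * Th x n.+1%:R y) @[n --> \oo] -->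
  \int[lambda]_(y in cube) (h y * lower_box x y).
Proof.
move=> xo ih.
have mh : measurable_fun cube h by have /measurable_int/measurable_EFinP := ih.
have mc := measurable_cube.
have := @dominated_convergence _ _ _ lambda cube mc
  (fun n y => (h y * Th x n.+1%:R y)%:E) (fun y => (h y * lower_box x y)%:E)
  (fun y => `|h y|%:E).
move=> /(_ _ _ _ _ _)[].
- by move=> n; apply/measurable_EFinP/measurable_funM => //; exact: measurable_funTS.
- apply/measurable_EFinP/measurable_funM => //; apply: measurable_funTS.
  exact: measurable_lower_box.
- apply: aeW => y _; apply/cvg_EFin; first by near=> n.
  by apply: cvgMr; exact: cvg_Th.
- exact: (integrable_norm ih).
- apply: aeW => y n _; rewrite lee_fin normrM ler_piMr//.
  by rewrite ger0_norm ?Th_ge0// Th_le1.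
move=> il _; have fl := integrable_fin_num mc il.
by move=> c; apply: fine_cvg; rewrite fineK.
Unshelve. all: by end_near. Qed.

Let test_Th x k : open_unit_cube R d x -> 0 < k -> test_function (Th x k).
Proof.
move=> xo k0; apply: (@test_function_prod_coord _ _ _ (fun=> k^-1) (fun i => x ord0 i)).
- by move=> i; exact: smooth_cutoff.
- by move=> i; rewrite invr_gt0.
- by move=> i; have := xo i; rewrite in_itv/= => /andP[].
- by move=> i t; exact: cutoff_support.
Qed.

Let partial_Th x k y : 0 < k -> (forall i, 2 / k < y ord0 i) ->
  partial_multi (fun=> 1%N) (Th x k) y = (-1) ^+ d * Bp x k y.
Proof.
move=> k0 ky; rewrite partial_multi1_prod_coord; last by move=> i; exact: smooth_cutoff.
rewrite /Bp /prod_coord; under eq_bigr do rewrite derive1_cutoff//.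
by rewrite prodrN card_ord.
Qed.

Let Bp_support x k y : 0 < k -> Bp x k y != 0 ->
  forall i, `|x ord0 i - y ord0 i| <= k^-1.
Proof.
move=> k0 + i; rewrite /Bp /prod_coord (bigD1 i)//= mulf_eq0 negb_or => /andP[h _].
by have /andP[h0 h1] := step_kernel_support k0 h; rewrite ger0_norm.
Qed.

(* Since [g] vanishes near the faces [y_i = 0], only the part of the derivative of
   the cut-offs that concentrates at [x] contributes.  The bound on [g - l] is only
   asked almost everywhere, so that [g] may be the given Sobolev function and [l]
   the value of its continuous representative. *)
Lemma weak_derivative_representation g h x (l delta : R) :
  lambda.-integrable cube (EFin \o g) -> lambda.-integrable cube (EFin \o h) ->
  (forall eta : E -> R, test_function eta ->
     \int[lambda]_(y in cube) (g y * partial_multi (fun=> 1%N) eta y) =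
     (-1) ^+ d * \int[lambda]_(y in cube) (h y * eta y)) ->
  0 < delta -> (forall y, cube y -> forall i, y ord0 i < delta -> g y = 0) ->
  open_unit_cube R d x ->
  (forall e, 0 < e -> exists2 r, 0 < r & {ae lambda, forall y, cube y ->
     (forall i, `|x ord0 i - y ord0 i| < r) -> `|g y - l| <= e}) ->
  l = \int[lambda]_(y in cube) (h y * lower_box x y).
Proof.
move=> ig ih gh delta0 gdelta xo gl.
have mc := measurable_cube.
have mg : measurable_fun cube g by have /measurable_int/measurable_EFinP := ig.
have cv := cvg_integral_Th xo ih.
suff : \int[lambda]_(y in cube) (h y * Th x n.+1%:R y) @[n --> \oo] --> l.
  by move=> cl; apply/esym; exact: (cvg_unique _ cv cl).
apply/cvgrPdist_le => e e0; have [r r0 gr] := gl _ e0.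
have small (s : R) : 0 < s -> \forall n \near \oo, n.+1%:R^-1 < s.
  move=> s0; near=> n; rewrite invf_plt ?posrE// (@lt_le_trans _ _ n%:R)// ?ler_nat//.
  by near: n; exact: nbhs_infty_gtr.
have smallx : \forall n \near \oo, forall i, (n.+1%:R^-1 : R) <= x ord0 i.
  apply: filter_forall => i; have : 0 < x ord0 i.
    by have := xo i; rewrite in_itv/= => /andP[].
  by move/small; apply: filterS => n /ltW.
(* Three demands on k = n + 1: the rise of the cut-offs, below 2 / k, falls in the strip where [g]
   vanishes; the kernel lives within [r] of [x]; and 1 / k <= x_i gives it mass 1. *)
near=> n.
have kd : 2 / n.+1%:R < delta.
  by rewrite mulrC -ltr_pdivlMr//; near: n; apply: small; rewrite divr_gt0.
have kr : (n.+1%:R^-1 : R) < r by near: n; exact: small.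
have kx i : (n.+1%:R^-1 : R) <= x ord0 i by move: i; near: n.
set k : R := n.+1%:R in kd kr kx *.
have k0 : 0 < k by rewrite ltr0n.
have iB : (\int[lambda]_(y in cube) (Bp x k y)%:E = 1)%E.
  apply: integral_prod_coord => [i|i t|i].
  - exact: measurable_step_kernel.
  - exact: step_kernel_ge0.
  - apply: integral_step_kernel => //; first by rewrite -ler_pdivrMl// mulr1.
    by have := xo i; rewrite in_itv/= => /andP[_ /ltW].
have mB : measurable_fun cube (Bp x k) by exact: measurable_funTS.
have aebound : (\int[lambda]_(y in cube) `|(g y - l) * Bp x k y|%:E <= e%:E)%E.
  rewrite -[leRHS]mule1 -iB -ge0_integralZl//=; last 3 first.
  - exact/measurable_EFinP.
  - by move=> y _; rewrite lee_fin Bp_ge0.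
  - by rewrite lee_fin ltW.
  apply: ae_ge0_le_integral => //.
  - apply/measurable_EFinP/measurableT_comp => //.
    by apply: measurable_funM => //; exact: measurable_funB.
  - by move=> y _; rewrite -EFinM lee_fin mulr_ge0 ?Bp_ge0// ltW.
  - by apply/measurable_EFinP/measurable_funM.
  move: gr; apply: filterS => y gr yc.
  rewrite -EFinM lee_fin normrM [X in _ * X]ger0_norm ?Bp_ge0//.
  have [->|B0] := eqVneq (Bp x k y) 0; first by rewrite !mulr0.
  rewrite ler_wpM2r ?Bp_ge0// gr// => i.
  by rewrite (le_lt_trans (Bp_support k0 B0 i)).
have iBint : lambda.-integrable cube (EFin \o Bp x k).
  apply/integrableP; split; first exact/measurable_EFinP.
  rewrite (eq_integral (fun y => (Bp x k y)%:E)); first by rewrite iB ltry.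
  by move=> y _ /=; rewrite ger0_norm// Bp_ge0.
(* The averaging bound itself shows that (g - l) [Bp] is integrable; adding l [Bp] then gives
   integrability of g [Bp]. *)
have igl : lambda.-integrable cube (EFin \o (fun y => (g y - l) * Bp x k y)).
  apply/integrableP; split.
    by apply/measurable_EFinP; apply: measurable_funM => //; exact: measurable_funB.
  by apply: le_lt_trans aebound _; rewrite ltry.
have igB : lambda.-integrable cube (EFin \o (fun y => g y * Bp x k y)).
  have := integrableD mc igl (integrableZl mc l iBint).
  apply: eq_integrable => // y _ /=.
  by rewrite -EFinM -EFinD -mulrDl subrK.
(* If some coordinate is below [delta], both integrands vanish with [g]. Otherwise all coordinates
   exceed 2 / k, and the d minus signs of the mixed derivative cancel the sign in the definition of
   weak derivative. *)
have -> : \int[lambda]_(y in cube) (h y * Th x k y) =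
    \int[lambda]_(y in cube) (g y * Bp x k y).
  have := gh _ (test_Th xo k0).
  rewrite (@eq_Rintegral _ _ _ _ _ (fun y => (-1) ^+ d * (g y * Bp x k y))).
    by rewrite RintegralZl// => /(mulfI (negbT (signr_eq0 _ _))).
  move=> y /set_mem yc.
  have [[i yi]|/forallNP yi] := pselect (exists i, y ord0 i < delta).
    by rewrite (gdelta _ yc _ yi) !mul0r mulr0.
  rewrite partial_Th//; first by rewrite mulrCA.
  by move=> i; apply: lt_le_trans kd _; rewrite leNgt; exact/negP.
have -> : \int[lambda]_(y in cube) (g y * Bp x k y) =
    \int[lambda]_(y in cube) ((g y - l) * Bp x k y) + l.
  have El : l = \int[lambda]_(y in cube) (l * Bp x k y).
    by rewrite RintegralZl// /Rintegral iB mulr1.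
  rewrite [X in _ + X]El -RintegralD//; last exact: (integrableZl mc l iBint).
  by apply: eq_Rintegral => y _; rewrite -mulrDl subrK.
rewrite opprD addrCA subrr addr0 normrN.
apply: le_trans (le_normr_Rintegral mc igl) _.
rewrite -lee_fin; apply: le_trans aebound; rewrite /Rintegral fineK//.
exact: integrable_fin_num (integrable_norm igl).
Unshelve. all: by end_near. Qed.
End representation.

(** * Fubini's theorem for charges *)

Section fubini_sections.
Context d1 d2 (T1 : measurableType d1) (T2 : measurableType d2) (R : realType).
Variable m2 : {sigma_finite_measure set T2 -> \bar R}.
Variables (C : set T2) (mC : measurable C).
Variable h : T2 -> R.
Hypothesis ih : m2.-integrable C (EFin \o h).
Variables (S : set (T1 * T2)) (mS : measurable S).

Definition section_integral (z : T1) : R :=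
  \int[m2]_(y in C) (h y * \1_S (z, y)).

Section finite_measure.
Variable m1 : {finite_measure set T1 -> \bar R}.

Let hC : T2 -> R := h \_ C.

Let ihC : m2.-integrable setT (EFin \o hC).
Proof. by have := (integrable_mkcond _ mC).1 ih; rewrite restrict_EFin. Qed.

Let mhC : measurable_fun setT hC.
Proof. by have /measurable_int/measurable_EFinP := ihC. Qed.

Let f (p : T1 * T2) : \bar R := (hC p.2 * \1_S p)%:E.

Let mf : measurable_fun setT f.
Proof.
apply/measurable_EFinP; apply: measurable_funM; last exact: measurable_indic.
exact: measurableT_comp mhC measurable_snd.
Qed.

Let mf1 z : measurable_fun setT (fun y => f (z, y)).
Proof. exact: measurableT_comp mf (pair1_measurable z). Qed.

Let if1 z : m2.-integrable setT (fun y => f (z, y)).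
Proof.
apply: le_integrable ihC => // y _.
by rewrite /f /= lee_fin normrM ler_piMr// indicE normr_nat lern1 leq_b1.
Qed.

Let FE z : fubini_F m2 f z = (section_integral z)%:E.
Proof.
rewrite /section_integral /fubini_F Rintegral_mkcond /Rintegral fineK.
  apply: eq_integral => y _; rewrite /f/= patchE /hC patchE.
  by case: ifP => //; rewrite mul0r.
apply: integrable_fin_num => //.
apply: eq_integrable (if1 z) => // y _; rewrite /f/= patchE /hC patchE.
by case: ifP => //; rewrite mul0r.
Qed.

(** For each [z] the inner integral of the absolute value is at most the L^1 norm of [h] on [C], a
    constant, which the finite measure [m1] integrates. *)
Let iff : (m1 \x m2)%E.-integrable setT f.
Proof.
apply/integrable12ltyP => //.
have c_lty : (\int[m2]_y `|(hC y)%:E| < +oo)%E by case/integrableP : ihC.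
apply: (@le_lt_trans _ _ (\int[m1]_x (cst (\int[m2]_y `|(hC y)%:E|) x))%E).
  apply: ge0_le_integral => //.
  - by move=> x _; apply: integral_ge0.
  - apply: (measurable_fun_fubini_tonelli_F (abse \o f)) => //=.
    exact: measurableT_comp.
  - move=> x _; apply: ge0_le_integral => //.
    + exact: measurableT_comp.
    + by apply: measurableT_comp => //; apply/measurable_EFinP.
    + move=> y _; rewrite /f /= lee_fin normrM ler_piMr//.
      by rewrite indicE normr_nat lern1 leq_b1.
rewrite integral_cst//; apply: lte_mul_pinfty.
- exact: integral_ge0.
- by rewrite ge0_fin_numE// integral_ge0.
- by rewrite ltey_eq fin_num_measure.
Qed.

Lemma integrable_section_integral : m1.-integrable setT (EFin \o section_integral).
Proof.
by apply: eq_integrable (integrable_fubini_F iff) => // z _; rewrite FE.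
Qed.

Lemma integrable_ysection_measure :
  m2.-integrable C (EFin \o (fun y => h y * fine (m1 (ysection S y)))).
Proof.
have mh : measurable_fun C h by have /measurable_int/measurable_EFinP := ih.
apply: (le_integrable mC _ _ (integrableZl mC (fine (m1 setT)) ih)).
  apply/measurable_EFinP/measurable_funM => //; apply: measurable_funTS.
  by apply: measurableT_comp => //; exact: measurable_fun_ysection.
move=> y _; rewrite -EFinM !abse_EFin lee_fin [leRHS]normrM mulrC normrM ler_wpM2r//.
rewrite !ger0_norm ?fine_ge0// fine_le ?fin_num_measure//; first exact: measurable_ysection.
by apply: le_measure => //; rewrite inE//; exact: measurable_ysection.
Qed.

Lemma Rintegral_section_integral :
  \int[m1]_z section_integral z =
  \int[m2]_(y in C) (h y * fine (m1 (ysection S y))).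
Proof.
rewrite [RHS]Rintegral_mkcond /Rintegral; congr fine.
transitivity (\int[m1]_x fubini_F m2 f x)%E.
  by apply: eq_integral => x _; rewrite FE.
rewrite integral12_prod_meas1// -integral21_prod_meas1//.
apply: eq_integral => y _; rewrite /fubini_G /f/= patchE.
have -> : hC y = if y \in C then h y else 0 by rewrite /hC patchE.
case: ifP => _; last first.
  by under eq_integral do rewrite mul0r; rewrite integral0.
under eq_integral do rewrite EFinM.
rewrite integralZl//; last first.
  apply: (@eq_integrable _ _ _ m1 setT measurableT (EFin \o \1_(ysection S y))).
    by move=> x _ /=; rewrite !indicE /ysection mem_setE.
  exact/integrable_indic/measurable_ysection.
rewrite EFinM fineK ?fin_num_measure//; last exact: measurable_ysection.
congr (_ * _)%E; rewrite -[X in m1 X]setIT -integral_indic//; last exact: measurable_ysection.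
by apply: eq_integral => x _; rewrite !indicE /ysection mem_setE.
Qed.

End finite_measure.
End fubini_sections.

Lemma Rintegral_sum d (T : measurableType d) (R : realType) (mu : {measure set T -> \bar R})
  (D : set T) (mD : measurable D) (I : Type) (s : seq I) (f : I -> T -> R) :
  (forall i, mu.-integrable D (EFin \o f i)) ->
  \int[mu]_(x in D) (\sum_(i <- s) f i x) = \sum_(i <- s) \int[mu]_(x in D) f i x.
Proof.
move=> fi; elim: s => [|i s IH].
  rewrite big_nil (@eq_Rintegral _ _ _ _ _ (fun=> 0)); last by move=> x _; rewrite big_nil.
  by rewrite Rintegral_cst// mul0r.
rewrite big_cons -IH -RintegralD//.
  by apply: eq_Rintegral => x _; rewrite big_cons.
apply: eq_integrable (@integrable_sum _ _ _ mu D mD _ s xpredT _ (fun i _ => fi i)) => //.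
by move=> x _; rewrite /= sumEFin.
Qed.

Lemma fine_jordan d (T : measurableType d) (R : realType)
    (nu : {charge set T -> \bar R}) (P N : set T) (nuPN : hahn_decomposition nu P N)
    (B : set T) : measurable B ->
  fine (nu B) = fine (jordan_pos nuPN B) - fine (jordan_neg nuPN B).
Proof.
move=> mB.
have -> : nu B = (jordan_pos nuPN B + (-1)%:E * jordan_neg nuPN B)%E.
  exact: jordan_decomp.
have fp : jordan_pos nuPN B \is a fin_num by exact: fin_num_measure.
have fn : jordan_neg nuPN B \is a fin_num by exact: fin_num_measure.
by rewrite EFinN mulN1e fineD ?fin_numN// fineN.
Qed.

(** Linearity and Fubini are used separately for the two Jordan parts, which are finite positive
    measures; under the integral over [y] their difference becomes the charge of the fibre again.
    The sum over [k] stays inside because the function to be integrated is the whole sum. *)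
Lemma charge_integral_section_integral d1 d2 (T1 : measurableType d1)
    (T2 : measurableType d2) (R : realType) (nu : {charge set T1 -> \bar R})
    (m2 : {sigma_finite_measure set T2 -> \bar R}) (C : set T2)
    (K : nat) (h : 'I_K -> T2 -> R) (S : 'I_K -> set (T1 * T2)) :
  measurable C -> (forall k, m2.-integrable C (EFin \o h k)) ->
  (forall k, measurable (S k)) ->
  charge_integral nu (fun z => \sum_(k < K) section_integral m2 C (h k) (S k) z) =
  \sum_(k < K) \int[m2]_(y in C) (h k y * fine (nu (ysection (S k) y))).
Proof.
move=> mC ih mS; rewrite /charge_integral.
pose nuPN := projT2 (cid (projT2 (cid (Hahn_decomposition nu)))).
rewrite -/nuPN.
rewrite !Rintegral_sum//; last 2 first.
- by move=> k; exact: integrable_section_integral.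
- by move=> k; exact: integrable_section_integral.
rewrite -sumrB; apply: eq_bigr => k _.
rewrite !Rintegral_section_integral// -RintegralB//; last 2 first.
- exact: integrable_ysection_measure.
- exact: integrable_ysection_measure.
apply: eq_Rintegral => y _; rewrite -mulrBr; congr (_ * _).
have mSy := measurable_ysection y (mS k).
by rewrite -fine_jordan.
Qed.

(** * Charts *)

Section chart.
Variables (R : realType) (d : nat) (M : ptopologicalType).
Local Notation E := 'rV[R]_d.
Local Notation cube := (unit_cube R d).
Local Notation open_cube := (open_unit_cube R d).
Variables (A : set (set E * (E -> M))) (phi : E -> M) (psi : M -> R).
Hypotheses (hphi : cube_chart A phi) (hpsi : smooth_function A psi).
Hypothesis supp_psi : closure [set y | psi y != 0] `<=` (phi @` cube)°.

Lemma open_cube_cube : open_cube `<=` cube.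
Proof. by move=> x xo i; apply: subset_itv_oo_cc (xo i). Qed.

Lemma interior_cube x : nbhs x cube -> open_cube x.
Proof.
move=> /nbhs_ballP[e /= e0 xe] i.
have e20 : 0 < e / 2 by rewrite divr_gt0.
have mem (c : R) : `|c| < e -> x ord0 i + c \in `[0, 1].
  move=> ce; have := xe (\row_j (x ord0 j + c)); rewrite /cube /=.
  move=> /(_ _ i); rewrite mxE; apply; split => // a b.
  by rewrite mxE (ord1 a) /ball/= opprD addNKr normrN.
have hc : `|e / 2| < e by rewrite ger0_norm ?ltW// gtr_pMr// invf_lt1// ltr1n.
have := mem _ hc; have := mem (- (e / 2)); rewrite normrN => /(_ hc).
rewrite !in_itv/= => /andP[h1 _] /andP[_ h2].
by apply/andP; split; [rewrite (lt_le_trans e20)// -subr_ge0|rewrite (lt_le_trans _ h2)// ltrDl].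
Qed.

Lemma open_box (a b : 'I_d -> R) :
  open [set x : E | forall i, x ord0 i \in `]a i, b i[].
Proof.
rewrite openE => x xo.
apply: (@filter_forall E _ (fun i (y : E) => y ord0 i \in `]a i, b i[) (nbhs x)) => i.
have h : nbhs (x ord0 i) [set` `]a i, b i[].
  by apply: open_nbhs_nbhs; split; [exact: interval_open|exact: xo].
exact: (@coord_continuous R 1 d ord0 i x _ h).
Qed.

Lemma phi_inj : {in cube &, injective phi}.
Proof.
have [p [[[_ _ inj _] _] cp eqp]] := hphi.
move=> x y xc yc xy; apply: inj; [exact/mem_set/cp/set_mem|exact/mem_set/cp/set_mem|].
by rewrite !eqp.
Qed.

Lemma open_image V : open V -> V `<=` open_cube -> open (phi @` V).
Proof.
have [p [[[_ _ _ op] _] cp eqp]] := hphi.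
move=> oV Vo; have -> : phi @` V = p.2 @` V.
  by apply: eq_imagel => x Vx; rewrite eqp//; exact/mem_set/open_cube_cube/Vo.
by apply: op => // x /Vo/open_cube_cube/cp.
Qed.

(** The chart extends continuously and injectively to an open neighbourhood of the cube. A point
    near [x] that is sent into the image of the cube must then lie in the cube, so the cube is a
    neighbourhood of [x]. *)
Lemma chart_interior x : cube x -> (phi @` cube)° (phi x) -> open_cube x.
Proof.
have [p [[[op cont inj _] _] cp eqp]] := hphi.
move=> xc zO; apply: interior_cube.
have px : p.2 x = phi x by rewrite eqp//; exact/mem_set.
have xp : p.1 x by exact: cp.
have : nbhs x (p.2 @^-1` (phi @` cube)).
  by apply: (cont x (mem_set xp)); rewrite px.
have : nbhs x p.1 by exact: open_nbhs_nbhs.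
apply: filterS2 => y py [y' y'c]; rewrite -eqp ?inE// => /inj <- //; rewrite ?inE//.
exact: cp.
Qed.

Lemma psi_neq0_chart z : psi z != 0 -> exists2 x, open_cube x & phi x = z.
Proof.
move=> z0; have zO : (phi @` cube)° z by exact/supp_psi/subset_closure.
have [x xc xz] := interior_subset zO; exists x => //.
by apply: chart_interior => //; rewrite xz.
Qed.

(** Near a point over the support of [psi], which is interior to the cube, all coordinates stay
    above some positive number; near any other point [psi] vanishes. Compactness of the cube makes
    the margin uniform. *)
Lemma psi_margin : exists2 delta, 0 < delta & forall y, cube y ->
  forall i, y ord0 i < delta -> psi (phi y) = 0.
Proof.
have [p [[[op cont inj _] _] cp eqp]] := hphi.
have cc : compact cube.
  by apply: (@rV_compact R d (fun=> `[0, 1]%classic)) => i; exact: segment_compact.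
have main : \forall delta \near (0 : R)^'+,
    cube `<=` [set y : E | forall i, y ord0 i < delta -> psi (phi y) = 0].
  apply: (near_covering_withinP cube).2.
    exact: (compact_near_coveringP cube).1.
  move=> x xc.
  have px : p.2 x = phi x by rewrite eqp//; exact/mem_set.
  have xp : p.1 x by exact: cp.
  have [xF|xF] := pselect (closure [set y | psi y != 0] (phi x)).
    have xo : open_cube x by apply: chart_interior => //; exact: supp_psi.
    have : filter_prod (nbhs x) ((0 : R)^'+) (fun q : E * R => forall i, q.2 < q.1 ord0 i).
      apply: (@filter_forall (E * R) _ (fun i p => p.2 < p.1 ord0 i)
        (filter_prod (nbhs x) ((0 : R)^'+))) => i.
      have : 0 < x ord0 i by have := xo i; rewrite in_itv/= => /andP[].
      move=> x0; have x20 : 0 < x ord0 i / 2 by rewrite divr_gt0.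
      exists ([set y : E | x ord0 i / 2 < y ord0 i], [set e | e < x ord0 i / 2]).
        split => /=; last exact: nbhs_right_lt.
        have h : nbhs (x ord0 i) [set t | x ord0 i / 2 < t].
          by apply: lt_nbhsr; rewrite ltr_pdivrMr// mulr2n mulrDr mulr1 ltrDl.
        exact: (@coord_continuous R 1 d ord0 i x _ h).
      by move=> [y e] /= [h1 h2]; exact: lt_trans h1.
    apply: filterS => -[y delta] /= yd _ i yi.
    by have := lt_trans yi (yd i); rewrite ltxx.
  have : nbhs x (p.2 @^-1` (~` closure [set y | psi y != 0])).
    apply: (cont x (mem_set xp)); rewrite px; apply: open_nbhs_nbhs; split => //.
    exact/closed_openC/closed_closure.
  move=> nx; exists (p.2 @^-1` (~` closure [set y | psi y != 0]), setT).
    by split => //; exact: filterT.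
  move=> [y e] /= [h _] yc i _; rewrite -eqp ?inE//.
  by apply: contra_notP h => /eqP ?; exact: subset_closure.
have [delta [/= delta0 h]] := filter_ex (filterI (nbhs_right_gt (0 : R)) main).
by exists delta => // y yc i; exact: h.
Qed.


(* The fibre over [y] is the image of the box of all [x] with [y_i < x_i < 1] when
   all [y_i] are positive, and empty otherwise (unless [d = 0]). *)
Definition lower_set : set (borel M * E) :=
  [set q : borel M * E | exists2 x, open_cube x & phi x = q.1 /\
    forall i, (0 < q.2 ord0 i) && (q.2 ord0 i < x ord0 i)].

(** A rational number between y_i and x_i witnesses each strict inequality, so the set is a
    countable union of rectangles, each the product of an open subset of [M] and a box. *)
Lemma measurable_lower_set : measurable lower_set.
Proof.
(* The union runs over all rational vectors, also with negative entries; the maximum with 0 keeps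
   the box in the open cube, where the chart is open. *)
pose V (r : {ffun 'I_d -> rat}) : set E :=
  [set x | forall i, x ord0 i \in `]Num.max 0 (ratr (r i)), 1[].
pose Y (r : {ffun 'I_d -> rat}) : set E :=
  [set y | forall i, y ord0 i \in `]0, ratr (r i)]].
have Vo r : V r `<=` open_cube.
  move=> x xV i; have := xV i; rewrite !in_itv/= => /andP[h ->]; rewrite andbT.
  by apply: le_lt_trans h; rewrite le_max lexx.
have -> : lower_set = \bigcup_r ((phi @` V r : set (borel M)) `*` Y r).
  apply/seteqP; split => [[z y] /= [x xo [xz yx]]|[z y] /= [r _ [/= [x xV xz] yr]]].
    have ex i : exists q : rat, ratr q \in `]y ord0 i, x ord0 i[.
      by apply: rat_in_itvoo; have /andP[] := yx i.
    have [r rP] := choice ex.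
    exists [ffun i => r i] => //; split => /=; [exists x => //|] => i;
      have := rP i; rewrite !in_itv/= ffunE => /andP[h1 h2]; have /andP[y0 _] := yx i.
      have := xo i; rewrite in_itv/= => /andP[x0 ->].
      by rewrite gt_max x0 h2.
    by rewrite y0 ltW.
  exists x; [exact: Vo xV|split => // i].
  have := xV i; have := yr i; rewrite !in_itv/= => /andP[-> h] /andP[h' _].
  by rewrite (le_lt_trans h)//; apply: le_lt_trans h'; rewrite le_max lexx orbT.
apply: countable_bigcupT_measurable; first exact: countableP.
move=> r; apply: measurableX.
  apply: sub_sigma_algebra; apply: open_image => //; exact: open_box.
exact: (@measurable_box _ _ (fun i => [set` `]0, ratr (r i)]])).
Qed.

Lemma ysection_lower_set y : exists2 J : 'I_d -> interval R,
  [set x : E | forall i, x ord0 i \in J i] `<=` cube &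
  ysection lower_set y = phi @` [set x : E | forall i, x ord0 i \in J i].
Proof.
(* The reversed interval []1, 0[] is empty, so an empty fibre is also presented as the image of a
   box. *)
pose J i := if 0 < y ord0 i then `]y ord0 i, 1[ else `]1%R, 0%R[.
have JE x i : (x ord0 i \in J i) =
    [&& 0 < y ord0 i, y ord0 i < x ord0 i & x ord0 i < 1].
  rewrite /J; case: ltP => y0; rewrite in_itv//=.
  by apply/negP => /andP[h1 h2]; have := lt_trans h1 h2; rewrite ltr10.
exists J => [x xJ i|].
  by have := xJ i; rewrite JE in_itv/= => /and3P[y0 yx x1]; rewrite !ltW// (lt_trans y0).
apply/seteqP; split => z.
  rewrite /ysection/= inE => -[x xo [/= xz yx]]; exists x => // i.
  by have := xo i; rewrite JE in_itv/= => /andP[_ ->]; rewrite andbT; exact: yx.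
move=> [x xJ xz]; rewrite /ysection/= inE; exists x => [i|].
  by have := xJ i; rewrite JE in_itv/= => /and3P[y0 yx ->]; rewrite (lt_trans y0).
by split => // i; have := xJ i; rewrite JE => /and3P[-> ->].
Qed.

Lemma lower_set_chart x y : open_cube x ->
  \1_lower_set (phi x : borel M, y) = lower_box x y.
Proof.
move=> xo; rewrite /lower_box /prod_coord.
have [h|h] := boolP [forall i, (0 < y ord0 i) && (y ord0 i < x ord0 i)].
  rewrite big1; last by move=> i _; rewrite (forallP h i).
  rewrite indicE mem_set//; exists x => //; split => // i; exact: (forallP h i).
have /existsP[i hi] : [exists i, ~~ ((0 < y ord0 i) && (y ord0 i < x ord0 i))].
  by rewrite -negb_forall.
rewrite (bigD1 i)//= (negbTE hi) mul0r indicE memNset// => -[x' xo' [/= xx' yx']].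
have xE : x' = x by apply: phi_inj => //; exact/mem_set/open_cube_cube.
by move/negP: hi; apply; rewrite -xE; exact: yx'.
Qed.

Lemma lower_set_out z y : (forall x, open_cube x -> phi x <> z) ->
  \1_lower_set (z : borel M, y) = 0 :> R.
Proof.
by move=> zo; rewrite indicE memNset// => -[x xo [/= xz _]]; exact: zo xo xz.
Qed.

(** Here [w] stands for a real component of the Sobolev function and [v] for its continuous
    representative: integrals see [w], while the conclusion holds at every point for [v]. Off the
    image of the open cube both sides are 0. *)
Lemma localization_representation (v w : M -> R) (h : E -> R) :
  continuous v ->
  {ae lebesgue_rV R d, forall y, cube y -> w (phi y) = v (phi y)} ->
  (lebesgue_rV R d).-integrable cube (EFin \o (fun y => psi (phi y) * w (phi y))) ->
  (lebesgue_rV R d).-integrable cube (EFin \o h) ->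
  (forall eta : E -> R, test_function eta ->
     \int[lebesgue_rV R d]_(y in cube)
       (psi (phi y) * w (phi y) * partial_multi (fun=> 1%N) eta y) =
     (-1) ^+ d * \int[lebesgue_rV R d]_(y in cube) (h y * eta y)) ->
  forall z, psi z * v z = section_integral (@leb R d) cube h lower_set z.
Proof.
move=> cv wv ig ih gh z; rewrite /section_integral.
have [[x xo <-]|zo] := pselect (exists2 x, open_cube x & phi x = z); last first.
  have -> : psi z = 0.
    by apply: contra_notP zo => /eqP/psi_neq0_chart.
  rewrite mul0r (@eq_Rintegral _ _ _ _ _ (fun=> 0)) ?Rintegral_cst ?mul0r//.
    exact: measurable_cube.
  move=> y _; rewrite lower_set_out ?mulr0// => x xo xz; apply: zo; by exists x.
have [delta delta0 margin] := psi_margin.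
rewrite (@weak_derivative_representation _ _ _ _ x (psi (phi x) * v (phi x)) delta ig ih gh)//.
- by apply: eq_Rintegral => y _; rewrite lower_set_chart.
- by move=> y yc i yi; rewrite (margin y yc i yi) mul0r.
move=> e e0.
(* Continuity is taken along the extended chart [p.2], since the values of [phi] outside the cube
   carry no meaning; the two agree at the points of the cube that are compared. *)
have [p [ps cp eqp]] := hphi; have [[op cont inj _] _] := ps.
have xc := open_cube_cube xo.
have cpsi : {for x, continuous (psi \o p.2)}.
  by have [+ _] := hpsi ps 0; apply; exact/mem_set/cp.
have cvp : {for x, continuous (v \o p.2)}.
  by apply: continuous_comp; [apply: cont; exact/mem_set/cp|exact: cv].
have cu : {for x, continuous (fun y => psi (p.2 y) * v (p.2 y))}.
  by exact: continuousM cpsi cvp.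
have /cvgrPdist_le/(_ _ e0)/nbhs_ballP[r /= r0 xr] := cu.
exists r => //; move: wv; apply: filterS => y wv yc yx.
rewrite wv// distrC -!eqp ?inE//; apply: xr; split => // a b.
by rewrite (ord1 a) /ball/= yx.
Qed.

End chart.

(** * The estimate *)

Section complex_integrals.
Context d (T : measurableType d) (R : realType) (mu : {measure set T -> \bar R}).
Variables (D : set T) (mD : measurable D) (F : T -> R[i]).
Hypothesis iRe : mu.-integrable D (EFin \o (fun x => complex.Re (F x))).
Hypothesis iIm : mu.-integrable D (EFin \o (fun x => complex.Im (F x))).

Let mRe : measurable_fun D (fun x => complex.Re (F x)).
Proof. by have /measurable_int/measurable_EFinP := iRe. Qed.

Let mIm : measurable_fun D (fun x => complex.Im (F x)).
Proof. by have /measurable_int/measurable_EFinP := iIm. Qed.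

Lemma measurable_normc : measurable_fun D (fun x => normc (F x)).
Proof.
rewrite (_ : (fun x => _) =
    (fun x => Num.sqrt (complex.Re (F x) ^+ 2 + complex.Im (F x) ^+ 2))).
  apply: measurableT_comp; first by apply: continuous_measurable_fun; exact: sqrt_continuous.
  by apply: measurable_funD; exact: measurable_funX.
by apply/funext => x; case: (F x).
Qed.

Lemma normc_ge0 (z : R[i]) : 0 <= normc z.
Proof. by case: z => a b; exact: sqrtr_ge0. Qed.

Lemma integrable_normc : mu.-integrable D (EFin \o (fun x => normc (F x))).
Proof.
apply: (le_integrable mD _ _ (integrableD mD (integrable_norm iRe) (integrable_norm iIm))).
  exact/measurable_EFinP/measurable_normc.
move=> x _ /=; rewrite lee_fin ger0_norm ?normc_ge0// ger0_norm ?addr_ge0//.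
exact: normc_le_Re_Im.
Qed.

(** With a + ib the integral and r its modulus, r^2 is the integral of a Re F + b Im F, which
    Cauchy-Schwarz bounds pointwise by r |F|. Estimating the two components separately would cost a
    factor. *)
Lemma normc_Rintegral_le :
  normc (Complex (\int[mu]_(x in D) complex.Re (F x)) (\int[mu]_(x in D) complex.Im (F x)))
  <= \int[mu]_(x in D) normc (F x).
Proof.
set a := \int[mu]_(x in D) complex.Re (F x); set b := \int[mu]_(x in D) complex.Im (F x).
set r := normc _; have [->|r0] := eqVneq r 0.
  by apply: Rintegral_ge0 => x _; exact: normc_ge0.
have {}r0 : 0 < r by rewrite lt_def r0 normc_ge0.
have rr : r * r = a * a + b * b.
  by rewrite -expr2 /r /= sqr_sqrtr ?addr_ge0 ?sqr_ge0// !expr2.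
rewrite -(ler_pM2l r0) rr -!RintegralZl//; last exact: integrable_normc.
rewrite -RintegralD//; [|exact: (integrableZl mD a iRe)|exact: (integrableZl mD b iIm)].
apply: le_Rintegral => //.
- exact: (integrableD mD (integrableZl mD a iRe) (integrableZl mD b iIm)).
- exact: (integrableZl mD r integrable_normc).
move=> x _; case: (F x) => u v /=; rewrite /r /=.
rewrite -sqrtrM ?addr_ge0 ?sqr_ge0//; apply: le_trans (ler_norm _) _.
rewrite -sqrtr_sqr ler_wsqrtr// -subr_ge0.
have -> : (a ^+ 2 + b ^+ 2) * (u ^+ 2 + v ^+ 2) - (a * u + b * v) ^+ 2 = (a * v - b * u) ^+ 2.
  by ring.
exact: sqr_ge0.
Qed.

End complex_integrals.

Lemma normc_sum (R : realType) (I : Type) (s : seq I) (z : I -> R[i]) :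
  normc (\sum_(i <- s) z i) <= \sum_(i <- s) normc (z i).
Proof.
elim: s => [|i s IH]; first by rewrite !big_nil ComplexField.Normc.normc0.
by rewrite !big_cons; apply: le_trans (le_normcD _ _) _; rewrite lerD2l.
Qed.

Lemma continuous_Re_Im (R : realType) (M : topologicalType) (fc : M -> R[i]) :
  continuous (fc : M -> R[i]^o) ->
  continuous (fun z => complex.Re (fc z)) /\ continuous (fun z => complex.Im (fc z)).
Proof.
have normE (z : R[i]) (e : R) : (`|z| < e%:C%C) = (normc z < e).
  by rewrite normc_def ltcR; case: z.
move=> cf; split=> z; apply/cvgrPdist_lt => e e0; have /cvgrPdist_lt := cf z;
  move=> /(_ e%:C%C); rewrite ltcR => /(_ e0); apply: filterS => y;
  rewrite normE -raddfB; apply: le_lt_trans.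
- exact: normc_Re_le.
- exact: normc_Im_le.
Qed.

(** Test functions and the sign are real, so the complex identity splits into its components. *)
Lemma is_weak_derivative_Re_Im (R : realType) (d : nat) (alpha : 'I_d -> nat)
    (g h : 'rV[R]_d -> R[i]) (eta : 'rV[R]_d -> R) :
  is_weak_derivative alpha g h -> test_function eta ->
  \int[lebesgue_rV R d]_(x in unit_cube R d)
     (complex.Re (g x) * partial_multi alpha eta x) =
   (-1) ^+ (\sum_i alpha i)%N * \int[lebesgue_rV R d]_(x in unit_cube R d)
     (complex.Re (h x) * eta x) /\
  \int[lebesgue_rV R d]_(x in unit_cube R d)
     (complex.Im (g x) * partial_multi alpha eta x) =
   (-1) ^+ (\sum_i alpha i)%N * \int[lebesgue_rV R d]_(x in unit_cube R d)
     (complex.Im (h x) * eta x).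
Proof.
move=> [_ _ gh] /gh.
have -> n : (-1) ^+ n = ((-1) ^+ n : R)%:C%C by rewrite rmorphXn rmorphN1.
have ReM (z : R[i]) (a : R) : complex.Re (z * a%:C%C) = complex.Re z * a.
  by case: z => u v /=; rewrite mulr0 subr0.
have ImM (z : R[i]) (a : R) : complex.Im (z * a%:C%C) = complex.Im z * a.
  by case: z => u v /=; rewrite mulr0 add0r.
rewrite /cube_integral => -[].
rewrite !mul0r subr0 addr0 => hR hI; split.
- rewrite (eq_Rintegral _ (fun y _ => esym (ReM _ _))) hR; congr (_ * _).
  by apply: eq_Rintegral => y _; rewrite ReM.
- rewrite (eq_Rintegral _ (fun y _ => esym (ImM _ _))) hI; congr (_ * _).
  by apply: eq_Rintegral => y _; rewrite ImM.
Qed.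

Lemma cube_Lp_norm1 (R : realType) (d : nat) (h : 'rV[R]_d -> R[i]) :
  cube_Lp_norm 1 h = (\int[lebesgue_rV R d]_(x in unit_cube R d) (normc (h x))%:E)%E.
Proof.
rewrite /cube_Lp_norm invr1 poweRe1; last first.
  by apply: integral_ge0 => x _; rewrite lee_fin powR_ge0.
by apply: eq_integral => x _; rewrite powRr1// normc_ge0.
Qed.

Lemma integrable_ysection_charge d1 d2 (T1 : measurableType d1)
    (T2 : measurableType d2) (R : realType) (nu : {charge set T1 -> \bar R})
    (m2 : {sigma_finite_measure set T2 -> \bar R}) (C : set T2)
    (h : T2 -> R) (S : set (T1 * T2)) :
  measurable C -> m2.-integrable C (EFin \o h) -> measurable S ->
  m2.-integrable C (EFin \o (fun y => h y * fine (nu (ysection S y)))).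
Proof.
move=> mC ih mS; have [P [N nuPN]] := Hahn_decomposition nu.
have := integrableB mC
  (integrable_ysection_measure mC ih mS (jordan_pos nuPN))
  (integrable_ysection_measure mC ih mS (jordan_neg nuPN)).
apply: eq_integrable => // y _ /=.
by rewrite (fine_jordan nuPN (measurable_ysection y mS)) -EFinB -mulrBr.
Qed.

(** * Summation over the charts *)

Section assembly.
Variables (R : realType) (d : nat) (M : ptopologicalType).
Local Notation E := 'rV[R]_d.
Local Notation cube := (unit_cube R d).
Variables (A : set (set E * (E -> M))) (K : nat) (phi : 'I_K -> E -> M).
Hypothesis hphi : forall k, cube_chart A (phi k).
Variable psi : 'I_K -> M -> R.
Hypothesis hpsi : smooth_partition_of_unity A phi psi.

(** The multi-index (1,..,1), whose order d is the highest that the norm admits. [inord 1] really is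
    1, since an index in ['I_d] forces d > 0. *)
Let one : {ffun 'I_d -> 'I_d.+1} := [ffun=> inord 1].

Let oneE : (fun i => one i : nat) = (fun=> 1%N).
Proof. by apply/funext => i; rewrite ffunE inordK// ltnS; case: i => m; case: d. Qed.

Let sum1d : (\sum_(i < d) 1 = d)%N.
Proof. by rewrite big_const_ord iter_addn mul1n addn0. Qed.

Let sum_one : (\sum_i one i = d)%N.
Proof. by rewrite -[RHS]sum1d; apply: eq_bigr => i _; exact: (congr1 (@^~ i) oneE). Qed.

(** This is the very representative chosen in [sobolev_norm], so its L^1 norm is literally one term
    of that sum of nonnegative terms. *)
Definition mixed_derivative (f : M -> R[i]) k : E -> R[i] :=
  weak_derivative (fun=> 1%N) (localization phi psi f k).

Lemma mixed_derivativeP f k : in_sobolev phi psi d 1 f ->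
  is_weak_derivative (fun=> 1%N) (localization phi psi f k) (mixed_derivative f k).
Proof.
move=> /(_ k one); rewrite oneE sum_one leqnn => /(_ isT)[h hw _].
exact: (@xgetPex _ (fun=> 0) [set h | is_weak_derivative _ _ h] (ex_intro _ h hw)).
Qed.

Lemma mixed_derivative_le_sobolev_norm f :
  (\sum_(k < K) \int[lebesgue_rV R d]_(x in cube) (normc (mixed_derivative f k x))%:E
    <= sobolev_norm phi psi d 1 f)%E.
Proof.
apply: lee_sum => k _; rewrite -cube_Lp_norm1 (bigD1 one)/=; last by rewrite sum_one.
rewrite oneE leeDl//; apply: sume_ge0 => alpha _; exact: poweR_ge0.
Qed.

Lemma localization_Re_Im f k y :
  complex.Re (localization phi psi f k y) = psi k (phi k y) * complex.Re (f (phi k y)) /\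
  complex.Im (localization phi psi f k y) = psi k (phi k y) * complex.Im (f (phi k y)).
Proof. by rewrite /localization; case: (f _) => a b /=; rewrite !mul0r subr0 addr0. Qed.

Lemma ae_equal_cube f fc k : ae_equal A f fc ->
  {ae lebesgue_rV R d, forall y, cube y -> f (phi k y) = fc (phi k y)}.
Proof.
have [p [ps cp eqp]] := hphi k => /(_ p ps); apply: negligibleS => y /= /not_implyP[yc ne].
by split; [exact: cp|rewrite /= eqp// inE].
Qed.

Section representation.
Variables (f fc : M -> R[i]).
Hypotheses (hf : in_sobolev phi psi d 1 f) (cfc : continuous (fc : M -> R[i]^o)).
Hypothesis ffc : ae_equal A f fc.
Local Notation h := (mixed_derivative f).

Let ih k : cube_integrable (h k).
Proof. by have [] := mixed_derivativeP k hf. Qed.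

Lemma Re_representation z : complex.Re (fc z) = \sum_(k < K)
  section_integral (@leb R d) cube (fun y => complex.Re (h k y)) (lower_set (phi k)) z.
Proof.
have [sm _ supp sum1] := hpsi; have [cRe _] := continuous_Re_Im cfc.
rewrite -[LHS]mul1r -(sum1 z) mulr_suml; apply: eq_bigr => k _.
have hw := mixed_derivativeP k hf.
have locE y := (localization_Re_Im f k y).1.
apply: (localization_representation (hphi k) (sm k) (supp k) cRe
  (w := fun z => complex.Re (f z))).
- by apply: filterS (ae_equal_cube k ffc) => y h yc; rewrite h.
- have [[+ _] _ _] := hw; apply: eq_integrable => [|y _ /=]; last by rewrite locE.
  exact: measurable_cube.
- by have [iR _] := ih k.
- move=> eta teta; have [+ _] := is_weak_derivative_Re_Im hw teta.
  rewrite sum1d => <-.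
  by apply: eq_Rintegral => y _; rewrite locE.
Qed.

Lemma Im_representation z : complex.Im (fc z) = \sum_(k < K)
  section_integral (@leb R d) cube (fun y => complex.Im (h k y)) (lower_set (phi k)) z.
Proof.
have [sm _ supp sum1] := hpsi; have [_ cIm] := continuous_Re_Im cfc.
rewrite -[LHS]mul1r -(sum1 z) mulr_suml; apply: eq_bigr => k _.
have hw := mixed_derivativeP k hf.
have locE y := (localization_Re_Im f k y).2.
apply: (localization_representation (hphi k) (sm k) (supp k) cIm
  (w := fun z => complex.Im (f z))).
- by apply: filterS (ae_equal_cube k ffc) => y h yc; rewrite h.
- have [[_ +] _ _] := hw; apply: eq_integrable => [|y _ /=]; last by rewrite locE.
  exact: measurable_cube.
- by have [_ iI] := ih k.
- move=> eta teta; have [_ +] := is_weak_derivative_Re_Im hw teta.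
  rewrite sum1d => <-.
  by apply: eq_Rintegral => y _; rewrite locE.
Qed.

Variable nu : complex_measure (borel M) R.

(** The integrand left by Fubini's theorem, as a complex product: its components combine the four
    pairings of real and imaginary parts. *)
Let F k y := h k y * nu (ysection (lower_set (phi k)) y).

Let mS k : measurable (lower_set (phi k)).
Proof. exact: (measurable_lower_set (hphi k)). Qed.

Let iRR k := integrable_ysection_charge (Re_measure nu) (m2 := @leb R d)
  (@measurable_cube R d) (ih k).1 (mS k).
Let iRI k := integrable_ysection_charge (Im_measure nu) (m2 := @leb R d)
  (@measurable_cube R d) (ih k).1 (mS k).
Let iIR k := integrable_ysection_charge (Re_measure nu) (m2 := @leb R d)
  (@measurable_cube R d) (ih k).2 (mS k).
Let iII k := integrable_ysection_charge (Im_measure nu) (m2 := @leb R d)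
  (@measurable_cube R d) (ih k).2 (mS k).

Let ReF k y : complex.Re (F k y) =
  complex.Re (h k y) * fine (Re_measure nu (ysection (lower_set (phi k)) y))
  - complex.Im (h k y) * fine (Im_measure nu (ysection (lower_set (phi k)) y)).
Proof. by rewrite /F /Re_measure /Im_measure /=; case: (h k y); case: (nu _). Qed.

Let ImF k y : complex.Im (F k y) =
  complex.Im (h k y) * fine (Re_measure nu (ysection (lower_set (phi k)) y))
  + complex.Re (h k y) * fine (Im_measure nu (ysection (lower_set (phi k)) y)).
Proof.
rewrite /F /Re_measure /Im_measure /=; case: (h k y) => a b; case: (nu _) => u v /=.
by rewrite addrC.
Qed.

Lemma cube_integrable_mul_measure k : cube_integrable (F k).
Proof.
split.
- have := integrableB (@measurable_cube R d) (iRR k) (iII k).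
  apply: eq_integrable => [|y _ /=]; first exact: measurable_cube.
  by rewrite ReF EFinB.
- have := integrableD (@measurable_cube R d) (iIR k) (iRI k).
  apply: eq_integrable => [|y _ /=]; first exact: measurable_cube.
  by rewrite ImF EFinD.
Qed.

Lemma complex_integral_representation :
  complex_integral nu fc = \sum_(k < K) cube_integral (F k).
Proof.
have RE := funext Re_representation; have IE := funext Im_representation.
rewrite /complex_integral RE IE !charge_integral_section_integral//; last 4 first.
all: try exact: measurable_cube.
all: try by move=> k; case: (ih k).
rewrite -sumrB -big_split /=.
have -> : \sum_(k < K) cube_integral (F k) = Complex
    (\sum_(k < K) complex.Re (cube_integral (F k)))
    (\sum_(k < K) complex.Im (cube_integral (F k))).
  by rewrite -!raddf_sum; case: (\sum_(k < K) _).
congr Complex; apply: eq_bigr => k _; rewrite /cube_integral /=.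
- rewrite -(RintegralB (@measurable_cube R d) (iRR k) (iII k)).
  by apply: eq_Rintegral => y _; rewrite ReF.
- rewrite -(RintegralD (@measurable_cube R d) (iIR k) (iRI k)).
  by apply: eq_Rintegral => y _; rewrite ImF.
Qed.

End representation.
End assembly.

Theorem theorem11 (R : realType) (d : nat) (M : ptopologicalType)
    (A : set (set 'rV[R]_d * ('rV[R]_d -> M)))
    (hM : compact_smooth_manifold A)
    (m : probability (borel M) R)
    (K : nat) (phi : 'I_K -> 'rV[R]_d -> M)
    (hphi : forall k, cube_chart A (phi k))
    (psi : 'I_K -> M -> R)
    (hpsi : smooth_partition_of_unity A phi psi) :
  exists2 c : R, 0 < c &
    forall (f fc : M -> R[i]) (mu : complex_measure (borel M) R),
      in_sobolev phi psi d 1 f ->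
      continuous (fc : M -> R[i]^o) -> ae_equal A f fc ->
      ((normc (complex_integral (conj_measure mu) fc))%:E <=
         c%:E * discrepancy phi mu * sobolev_norm phi psi d 1 f)%E.
Proof.
exists 1 => // f fc mu hf cfc ffc; rewrite mul1e.
have mc := @measurable_cube R d.
set D := discrepancy phi mu; set nu := conj_measure mu.
pose h k := mixed_derivative phi psi f k.
pose F k y := h k y * nu (ysection (lower_set (phi k)) y).
have ih k : cube_integrable (h k) by have [] := mixed_derivativeP k hf.
have iF k : cube_integrable (F k) := cube_integrable_mul_measure hphi hf nu k.
have normF k y : ((normc (F k y))%:E <= D * (normc (h k y))%:E)%E.
  rewrite /F ComplexField.Normc.normcM EFinM muleC lee_wpmul2r ?lee_fin ?normc_ge0//.
  have [J Jc JE] := ysection_lower_set (phi k) y.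
  apply: ereal_sup_ubound; exists (ysection (lower_set (phi k)) y).
    by exists k, J.
  by rewrite /nu /=; case: (mu _) => a b /=; rewrite sqrrN.
(* The supremum is nonnegative only if some interval exists, that is, if there is a chart: with K =
   0 the partition of unity would sum to 0. As [D] is an extended real, its sign is what allows it
   to be moved through integrals and sums. *)
have D0 : (0 <= D)%E.
  have [k _] : exists k : 'I_K, True.
    have [_ _ _ sum1] := hpsi; have [K0|K0] := posnP K; last by exists (Ordinal K0).
    have := sum1 point; rewrite big1 => [/eqP|k _]; first by rewrite eq_sym oner_eq0.
    by have := ltn_ord k; rewrite {2}K0.
  have [J Jc _] := ysection_lower_set (phi k) 0.
  pose U := phi k @` [set x : 'rV[R]_d | forall i, x ord0 i \in J i].
  apply: (@le_trans _ _ (normc (mu U))%:E).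
    by rewrite lee_fin normc_ge0.
  by apply: ereal_sup_ubound; eexists; first by exists k, J.
have bound k : ((normc (cube_integral (F k)))%:E <=
    D * \int[lebesgue_rV R d]_(x in unit_cube R d) (normc (h k x))%:E)%E.
  have [iR iI] := iF k.
  apply: (@le_trans _ _ (\int[lebesgue_rV R d]_(x in unit_cube R d) (normc (F k x))%:E)%E).
    have := normc_Rintegral_le mc iR iI; rewrite -lee_fin => /le_trans; apply.
    by rewrite /Rintegral fineK//; exact: integrable_fin_num (integrable_normc mc iR iI).
  have mh : measurable_fun (unit_cube R d) (fun x => normc (h k x)).
    by have [hR hI] := ih k; exact: (measurable_normc hR hI).
  rewrite -ge0_integralZl//; last 2 first.
  - by apply/measurable_EFinP.
  - by move=> x _; rewrite lee_fin normc_ge0.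
  apply: ge0_le_integral => //.
  - by move=> x _; rewrite lee_fin normc_ge0.
  - by apply/measurable_EFinP; exact: (measurable_normc iR iI).
  - by apply: measurable_funeM; apply/measurable_EFinP.
rewrite (complex_integral_representation hphi hpsi hf cfc ffc).
apply: (@le_trans _ _ (\sum_(k < K) normc (cube_integral (F k)))%:E).
  by rewrite lee_fin; exact: normc_sum.
apply: (@le_trans _ _ (D * \sum_(k < K)
    \int[lebesgue_rV R d]_(x in unit_cube R d) (normc (h k x))%:E)%E).
  rewrite -sumEFin ge0_sume_distrr; last first.
    by move=> k _; apply: integral_ge0 => x _; rewrite lee_fin normc_ge0.
  by apply: lee_sum => k _; exact: bound.
by apply: lee_wpmul2l => //; exact: mixed_derivative_le_sobolev_norm.
Qed.
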